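(* Let $\mathcal{D}=\{C_1,\ldots,C_k\}\subset \mathbb{P}^{2}_{\mathbb{C}}$ be a $d$-arrangement with $d\geq 3$ and $k\geq 3$ all of whose singularities are ordinary singularities of multiplicity less than $5$. Then $\mathcal{D}$ (the reduced curve defined by the product of the equations of the $C_i$) is never free.
   Context: A $d$-arrangement is an arrangement $\mathcal{D}=\{C_1,\ldots,C_k\}$ of irreducible plane curves such that every $C_i$ is smooth of degree $d\ge1$ and all intersection points are ordinary singularities (a point of multiplicity $m$ where $m$ smooth branches meet with pairwise distinct tangents). Let $S=\mathbb{C}[x,y,z]$ and for a homogeneous reduced $f\in S$ of degree $D$ let $M(f)=S/(\partial_x f,\partial_y f,\partial_z f)$. The curve $f=0$ is free if $M(f)$ has a minimal graded free resolution $0\to S(1-D-d_1)\oplus S(1-D-d_2)\to S^3(1-D)\to S$ with $d_1+d_2=D-1$. *)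

(* Defs.v *)
From HB Require Import structures.
From mathcomp Require Import all_boot all_order all_algebra.
From mathcomp Require Import reals.
From mathcomp Require Import complex.
From mathcomp Require Import mpoly.

Set Implicit Arguments.
Unset Strict Implicit.
Unset Printing Implicit Defensive.

Import Order.TTheory GRing.Theory Num.Theory.
Local Open Scope ring_scope.

Definition CC (R : realType) := R[i].

Notation S3 R := {mpoly (CC R)[3]}.

(* A point of P^2 is represented by a nonzero vector of C^3; all
   conditions below are invariant under rescaling (homogeneity). *)
Definition nonzero_vec (R : realType) (v : 'I_3 -> CC R) : Prop :=
  exists l, v l != 0.

Definition grad (R : realType) (f : S3 R) (v : 'I_3 -> CC R) : 'I_3 -> CC R :=
  fun l => (mderiv l f).@[v].

Definition irreducible_mpoly (R : realType) (f : S3 R) : Prop :=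
  f \isn't a GRing.unit /\ f != 0 /\
  forall g h : S3 R, f = g * h -> g \is a GRing.unit \/ h \is a GRing.unit.

Definition smooth_curve (R : realType) (f : S3 R) : Prop :=
  forall v : 'I_3 -> CC R, nonzero_vec v -> f.@[v] = 0 ->
    exists l, grad f v l != 0.

Definition proportional (R : realType) (a b : 'I_3 -> CC R) : Prop :=
  exists c : CC R, forall l, a l = c * b l.

(* A d-arrangement D = {C_1,...,C_k}, C_i = V(fs i):
   - each fs i is homogeneous of degree d, irreducible, and C_i is smooth;
   - the curves are pairwise distinct (fs i, fs j not associated for i <> j);
   - every intersection point is an ordinary singularity: the curves
     through the point are smooth branches, and their tangent lines
     (given by the gradients) are pairwise distinct. *)
Definition d_arrangement (R : realType) (d k : nat) (fs : 'I_k -> S3 R) : Prop :=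
  (1 <= d)%N /\
  (forall i, fs i \is d.-homog) /\
  (forall i, irreducible_mpoly (fs i)) /\
  (forall i, smooth_curve (fs i)) /\
  (forall i j, i != j -> ~ exists c : CC R, c != 0 /\ fs i = c *: fs j) /\
  (forall (v : 'I_3 -> CC R) i j, nonzero_vec v -> i != j ->
      (fs i).@[v] = 0 -> (fs j).@[v] = 0 ->
      ~ proportional (grad (fs i) v) (grad (fs j) v)).

(* Multiplicity of the point v in the curve defined by the product of the
   fs i: for an ordinary singularity (smooth branches = the curves through
   v), it is the number of curves through v. *)
Definition mult_at (R : realType) (k : nat) (fs : 'I_k -> S3 R)
    (v : 'I_3 -> CC R) : nat :=
  #|[set i | (fs i).@[v] == 0]|.

(* Freeness: M(f) = S/J_f has a minimal graded free resolution
     0 -> S(1-D-d1) (+) S(1-D-d2) --(rho1,rho2)--> S^3(1-D) --(f_x,f_y,f_z)--> S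
   with d1 + d2 = D - 1.  Concretely: rho1, rho2 are homogeneous syzygies of
   degrees d1, d2 of the Jacobian, forming a basis (injectivity + exactness
   at S^3) of the syzygy module, and all matrix entries of the two maps lie
   in the irrelevant ideal (minimality: zero constant term). *)
Definition is_syzygy (R : realType) (f : S3 R) (a : 'I_3 -> S3 R) : Prop :=
  \sum_(l < 3) a l * mderiv l f = 0.

Definition free_curve (R : realType) (f : S3 R) : Prop :=
  exists D : nat, f \is D.-homog /\
  exists (d1 d2 : nat) (rho1 rho2 : 'I_3 -> S3 R),
    (d1 + d2)%N = D.-1 /\
    (forall l, rho1 l \is d1.-homog) /\
    (forall l, rho2 l \is d2.-homog) /\
    is_syzygy f rho1 /\ is_syzygy f rho2 /\
    (forall g1 g2 : S3 R, (forall l, g1 * rho1 l + g2 * rho2 l = 0) ->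
        g1 = 0 /\ g2 = 0) /\
    (forall a : 'I_3 -> S3 R, is_syzygy f a ->
        exists g1 g2 : S3 R, forall l, a l = g1 * rho1 l + g2 * rho2 l) /\
    (forall l, (rho1 l)@_0%MM = 0 /\ (rho2 l)@_0%MM = 0 /\
               (mderiv l f)@_0%MM = 0).

(* Main.v *)
Require Import Defs.
From HB Require Import structures.
From mathcomp Require Import all_boot all_order all_algebra.
From mathcomp Require Import reals complex mpoly.
From mathcomp Require Import ring zify.
Import Order.TTheory GRing.Theory Num.Theory.
Local Open Scope ring_scope.
Set Implicit Arguments.
Unset Strict Implicit.
Unset Printing Implicit Defensive.

(** Let f be the product of the equations, D = kd its degree and J its Jacobian
    ideal.  If f is free with exponents d1 + d2 = D - 1, the resolution gives
    dim (S/J)_n = (D-1)^2 - d1 d2 >= 3/4 (D-1)^2 for n large.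

    Conversely, choose a line L = 0 missing all intersection points of the
    curves.  Multiplication by L on S/J is surjective, hence bijective, in large
    degrees, so that (S/J)_n embeds into S/(J, L - 1).  The latter algebra splits
    (Chinese remainder theorem) into its local parts at the points c with
    L(c) = 1, and at a point lying on m curves the local part has dimension at
    most (m-1)^2: the initial forms of the derivatives of f are the two
    derivatives of a product of m pairwise non-proportional linear forms, which
    are coprime binary forms of degree m-1.  For m <= 4 we have
    (m-1)^2 <= 3/4 m(m-1), and the sum of the m(m-1) counts pairs of curves
    meeting at a point, so it is at most k(k-1)d^2 by Bezout.  Altogether
    (D-1)^2 <= k(k-1)d^2 = D^2 - dD, which fails for d >= 2. *)

(** * Ideals and their codimension *)

(** Quotients, localisations and intersection multiplicities are avoided: an ideal is a predicate,
    and every upper bound on a codimension is an explicit spanning argument. The local part at a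
    point is reached by adjoining high powers of the coordinates centred there. The line $L=0$ acts
    twice as a line at infinity. It contains no singular point of $f$, so the restricted partial
    derivatives have no common zero on it; this makes $L$ surjective on $S/J$ in large degrees and
    $S/(J,L-1)$ finite-dimensional. It contains no common point of two curves, so the same
    degree-by-degree estimate yields Bezout as a bound on the number of points. Such a line is
    sought among the lines through a point $q$ off all curves. With $t$ naming the line and $s$ the
    point on it, two equations in $F[t][s]$ without common factor satisfy a Bezout relation with
    right-hand side in $F[t]$, which excludes only finitely many $t$. Euler's formula replaces
    tangent spaces: at a point of a curve, the derivatives along two vectors that form a basis with
    the point determine the gradient. *)

Section Codimension.

Variables (F : fieldType) (A : comAlgType F).
Implicit Types (I : A -> Prop) (x y g h : A).

Definition is_ideal I :=
  [/\ I 0, forall x y, I x -> I y -> I (x + y) & forall x y, I y -> I (x * y)].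

Definition adjoin I x : A -> Prop := fun g => exists h, I (g - h * x).

(** Only spanning modulo $I$ is asked, not independence, so this is an upper bound on the dimension
    of $A/I$ that needs no quotient. *)
Definition codim_le I (n : nat) :=
  exists b : 'I_n -> A, forall g, exists c : 'I_n -> F,
    I (g - \sum_i c i *: b i).

Section IdealTheory.

Variables (I : A -> Prop) (idI : is_ideal I).

Lemma ideal0 : I 0. Proof. by case: idI. Qed.
Lemma idealD x y : I x -> I y -> I (x + y). Proof. by case: idI => _ h _; apply: h. Qed.
Lemma idealMl x y : I y -> I (x * y). Proof. by case: idI => _ _ h; apply: h. Qed.
Lemma idealMr x y : I x -> I (x * y). Proof. by rewrite mulrC; apply: idealMl. Qed.
Lemma idealN x : I x -> I (- x). Proof. by rewrite -mulN1r; apply: idealMl. Qed.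
Lemma idealB x y : I x -> I y -> I (x - y).
Proof. by move=> Ix Iy; apply: idealD => //; apply: idealN. Qed.
Lemma idealZ c x : I x -> I (c *: x).
Proof. by move=> Ix; rewrite -[x]mul1r scalerAl; apply: idealMl. Qed.
Lemma ideal_sum (J : Type) (r : seq J) (P : pred J) (G : J -> A) :
  (forall j, P j -> I (G j)) -> I (\sum_(j <- r | P j) G j).
Proof. by move=> IG; elim/big_ind: _ => //; [apply: ideal0 | apply: idealD]. Qed.

Lemma ideal_congr x y : I (x - y) -> I y -> I x.
Proof. by move=> Ixy Iy; rewrite -(subrK y x); apply: idealD. Qed.

Lemma adjoin_ideal x : is_ideal (adjoin I x).
Proof.
split.
- by exists 0; rewrite mul0r subr0; apply: ideal0.
- move=> a b [h Ia] [k Ib]; exists (h + k).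
  have -> : a + b - (h + k) * x = (a - h * x) + (b - k * x) by ring.
  exact: idealD.
- move=> a b [h Ib]; exists (a * h).
  have -> : a * b - a * h * x = a * (b - h * x) by ring.
  exact: idealMl.
Qed.

Lemma adjoin_sub x g : I g -> adjoin I x g.
Proof. by exists 0; rewrite mul0r subr0. Qed.

Lemma adjoin_gen x : adjoin I x x.
Proof. by exists 1; rewrite mul1r subrr; apply: ideal0. Qed.

Lemma codim_le0 : I 1 -> codim_le I 0.
Proof.
move=> I1; exists (fun=> 0) => g; exists (fun=> 0).
by rewrite big_ord0 subr0 -[g]mulr1; apply: idealMl.
Qed.

Lemma ideal_nilD x y m n : I (x ^+ m) -> I (y ^+ n) -> I ((x + y) ^+ (m + n)).
Proof.
move=> Ix Iy; rewrite exprDn; apply: ideal_sum => i _; rewrite -mulr_natr; apply: idealMr.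
case: (leqP n i) => [le_ni|lt_in].
  by apply: idealMl; rewrite -(subnK le_ni) exprD; apply: idealMl.
apply: idealMr; have le : (m <= m + n - i)%N by lia.
by rewrite -(subnK le) exprD; apply: idealMl.
Qed.

Lemma ideal_nilMl x y m : I (x ^+ m) -> I ((y * x) ^+ m).
Proof. by rewrite exprMn; apply: idealMl. Qed.

(** A nonzero scalar minus a nilpotent is a unit: $c-h$ divides $c^m-h^m$, so $c^m$ falls into
    $I$. *)
Lemma ideal_unit_nil g c h m :
  c != 0 -> I g -> g = c%:A - h -> I (h ^+ m) -> I 1.
Proof.
move=> c0 Ig gE Ih.
have : I (c%:A ^+ m - h ^+ m) by rewrite subrXX -gE; apply: idealMr.
move=> /(idealD Ih); rewrite addrC subrK => Ic.
rewrite -(scale1r 1) -(mulVf (expf_neq0 m c0)) -scalerA; apply: idealZ.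
suff -> : c ^+ m *: (1 : A) = c%:A ^+ m by [].
by rewrite exprZn expr1n.
Qed.

End IdealTheory.

Lemma codim_le_sub I I' n : (forall g, I g -> I' g) -> codim_le I n -> codim_le I' n.
Proof. by move=> sub [b H]; exists b => g; have [c Ic] := H g; exists c; apply: sub. Qed.

Lemma cat_family n1 n2 (b1 : 'I_n1 -> A) (b2 : 'I_n2 -> A) :
  exists b : 'I_(n1 + n2) -> A, forall (c1 : 'I_n1 -> F) (c2 : 'I_n2 -> F),
  exists c : 'I_(n1 + n2) -> F,
    \sum_i c i *: b i = \sum_i c1 i *: b1 i + \sum_i c2 i *: b2 i.
Proof.
exists (fun i => match split i with inl i => b1 i | inr i => b2 i end) => c1 c2.
exists (fun i => match split i with inl i => c1 i | inr i => c2 i end).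
rewrite big_split_ord /=; congr (_ + _); apply: eq_bigr => i _.
  by rewrite -[lshift _ _]/(unsplit (inl _)) unsplitK.
by rewrite -[rshift _ _]/(unsplit (inr _)) unsplitK.
Qed.

(** The dimension form of the Chinese remainder theorem: in $g=w_1g+w_2g$ the factor $g$ of the
    $k$-th summand only matters modulo $I_k$. *)
Lemma codim_le_add I1 I2 I n1 n2 (w1 w2 : A) :
  is_ideal I ->
  (forall g, I1 g -> I (w1 * g)) -> (forall g, I2 g -> I (w2 * g)) ->
  w1 + w2 = 1 -> codim_le I1 n1 -> codim_le I2 n2 -> codim_le I (n1 + n2).
Proof.
move=> idI H1 H2 w12 [b1 B1] [b2 B2].
have [b B] := cat_family (fun i => w1 * b1 i) (fun i => w2 * b2 i).
exists b => g; have [c1 C1] := B1 g; have [c2 C2] := B2 g.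
have [c Ec] := B c1 c2; exists c; rewrite {}Ec.
under eq_bigr do rewrite scalerAr.
under [X in _ - (_ + X)]eq_bigr do rewrite scalerAr.
rewrite -!mulr_sumr -[g]mul1r -w12.
set s1 := \sum_i _; set s2 := \sum_i _.
have -> : (w1 + w2) * g - (w1 * s1 + w2 * s2) = w1 * (g - s1) + w2 * (g - s2) by ring.
by apply: idealD => //; [apply: H1 | apply: H2].
Qed.

(** With $up+vq=1$ the weights are $vq$ and $up$: multiplying by $vq$ turns $p(x)$ into a multiple
    of $(pq)(x)$, hence carries $I+(p(x))$ into $I$. *)
Lemma codim_le_coprime I x (p q : {poly F}) n1 n2 :
  is_ideal I -> coprimep p q -> I (horner_alg x (p * q)) ->
  codim_le (adjoin I (horner_alg x p)) n1 ->
  codim_le (adjoin I (horner_alg x q)) n2 -> codim_le I (n1 + n2).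
Proof.
move=> idI /Bezout_eq1_coprimepP [[u v] /= uv1] Ipq B1 B2.
apply: (codim_le_add (w1 := horner_alg x (v * q)) (w2 := horner_alg x (u * p)) _ _ _ _ B1 B2) => //.
- move=> g [h Ih].
  have -> : horner_alg x (v * q) * g =
    horner_alg x (v * q) * (g - h * horner_alg x p) + h * horner_alg x v * horner_alg x (p * q).
    by rewrite !rmorphM /=; ring.
  by apply: idealD => //; apply: idealMl.
- move=> g [h Ih].
  have -> : horner_alg x (u * p) * g =
    horner_alg x (u * p) * (g - h * horner_alg x q) + h * horner_alg x u * horner_alg x (p * q).
    by rewrite !rmorphM /=; ring.
  by apply: idealD => //; apply: idealMl.
- by rewrite -rmorphD addrC uv1 rmorph1.
Qed.

(** Roots are split off one at a time. The induction generalises $I$, because the remaining roots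
    are treated modulo $I$ together with their own product. *)
Lemma codim_le_prod_roots I x (rs : seq F) m (n : F -> nat) :
  is_ideal I -> uniq rs -> I (\prod_(r <- rs) (x - r%:A) ^+ m) ->
  (forall r, r \in rs -> codim_le (adjoin I ((x - r%:A) ^+ m)) (n r)) ->
  codim_le I (\sum_(r <- rs) n r).
Proof.
move=> idI; elim: rs I idI => [|r rs IH] I idI /=.
  by rewrite !big_nil => _ I1 _; apply: codim_le0.
case/andP=> r_rs uniq_rs Iprod H; rewrite big_cons.
have hX s : horner_alg x ('X - s%:P) = x - s%:A.
  by rewrite rmorphB /= horner_algX horner_algC.
pose p := ('X - r%:P) ^+ m; pose q := \prod_(s <- rs) ('X - s%:P) ^+ m.
have hp : horner_alg x p = (x - r%:A) ^+ m by rewrite rmorphXn /= hX.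
have hq : horner_alg x q = \prod_(s <- rs) (x - s%:A) ^+ m.
  by rewrite rmorph_prod; apply: eq_bigr => s _; rewrite rmorphXn /= hX.
apply: (@codim_le_coprime _ x p q) => //.
- rewrite /p /q big_seq; apply: (big_ind (fun t => coprimep _ t)).
  + exact: coprimep1.
  + by move=> a b ca cb; rewrite coprimepMr ca.
  move=> s s_rs; apply: coprimep_expl; apply: coprimep_expr.
  by rewrite coprimep_XsubC root_XsubC; apply: contra r_rs => /eqP <-.
- by rewrite rmorphM /= hp hq; move: Iprod; rewrite big_cons.
- by rewrite hp; apply: H; rewrite inE eqxx.
apply: IH => //; first exact: adjoin_ideal.
- by rewrite hq; apply: adjoin_gen.
move=> s s_rs; have := H s; rewrite inE s_rs orbT => /(_ isT).
apply: codim_le_sub => g [h Ih]; exists h; exact: adjoin_sub.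
Qed.

(** The coefficients of the $m$ elements in the spanning family form a matrix of rank at most $n<m$,
    so its rows are dependent. *)
Lemma codim_le_dependent I n m (u : 'I_m -> A) :
  is_ideal I -> codim_le I n -> (n < m)%N ->
  exists2 v : 'rV[F]_m, v != 0 & I (\sum_i v 0 i *: u i).
Proof.
move=> idI [b B] lt_nm.
have [C HC] : exists C : 'M[F]_(m, n), forall i, I (u i - \sum_j C i j *: b j).
  suff /fin_all_exists [c Hc] : forall i, exists c : 'I_n -> F, I (u i - \sum_j c j *: b j).
    by exists (\matrix_(i, j) c i j) => i; under eq_bigr do rewrite mxE.
  by move=> i; apply: B.
have : kermx C != 0.
  by rewrite kermx_eq0 -row_leq_rank -ltnNge; apply: leq_ltn_trans lt_nm; apply: rank_leq_col.
case/rowV0Pn => v /sub_kermxP vC v0; exists v => //.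
have -> : \sum_i v 0 i *: u i = \sum_i v 0 i *: (u i - \sum_j C i j *: b j).
  under [RHS]eq_bigr do rewrite scalerBr scaler_sumr.
  rewrite sumrB exchange_big /= [X in _ - X]big1 ?subr0 // => j _.
  under eq_bigr do rewrite scalerA.
  by rewrite -scaler_suml; have /matrixP/(_ 0 j) := vC; rewrite !mxE => ->; rewrite scale0r.
by apply: ideal_sum => // i _; apply: idealZ.
Qed.

(** The layers [K j] modulo [K j.+1] each need [c j] generators, and these add up along the
    filtration. It serves both the local filtration by powers of an ideal and the filtration by
    degree. *)
Lemma codim_le_filtration I (K : nat -> A -> Prop) (c : nat -> nat) N :
  is_ideal I ->
  (forall g, exists2 h, K 0%N h & I (g - h)) ->
  (forall g, K N g -> I g) ->
  (forall j, (j < N)%N -> exists b : 'I_(c j) -> A, forall g, K j g ->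
     exists e : 'I_(c j) -> F, exists2 h, K j.+1 h & I (g - \sum_i e i *: b i - h)) ->
  codim_le I (\sum_(j < N) c j).
Proof.
move=> idI K0 KN step.
(* Descending induction from the last layer, where everything already lies in $I$. *)
have spanK k : (k <= N)%N -> exists b : 'I_(\sum_(N - k <= j < N) c j) -> A,
    forall g, K (N - k)%N g -> exists e, I (g - \sum_i e i *: b i).
  elim: k => [|k IH] lekN.
    exists (fun=> 0) => g; rewrite subn0 => /KN Ig; exists (fun=> 0).
    by rewrite big1 ?subr0 // => i _; rewrite scaler0.
  have [b B] := IH (ltnW lekN).
  have ltj : (N - k.+1 < N)%N by lia.
  have [b1 B1] := step _ ltj.
  rewrite big_ltn // -subSn // subSS.
  have [b' B'] := cat_family b1 b; exists b' => g Kg.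
  have [e1 [h]] := B1 _ Kg; rewrite -subSn // subSS => Kh Ih.
  have [e Ie] := B _ Kh; have [e' Ee] := B' e1 e; exists e'; rewrite {}Ee.
  set s1 := \sum_i _ in Ih *; set s2 := \sum_i _ in Ie *.
  have -> : g - (s1 + s2) = (g - s1 - h) + (h - s2) by ring.
  exact: idealD.
have [b B] := spanK N (leqnn N).
rewrite subnn big_mkord in b B *.
exists b => g; have [h Kh Ih] := K0 g; have [e Ie] := B _ Kh; exists e.
set s := \sum_i _ in Ie *.
have -> : g - s = (g - h) + (h - s) by ring.
exact: idealD.
Qed.

End Codimension.

(** * Splitting a finite-dimensional quotient into its local parts *)

Section Points.

Variable F : closedFieldType.

(** The $n+1$ powers $1,x,\ldots,x^n$ are dependent modulo $I$; the resulting polynomial splits over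
    the closed field. *)
Lemma codim_le_annihilator (A : comAlgType F) (I : A -> Prop) n (x : A) :
  is_ideal I -> codim_le I n ->
  exists (rs : seq F) (m : nat), uniq rs /\ I (\prod_(r <- rs) (x - r%:A) ^+ m).
Proof.
move=> idI In.
have [v v0 Iv] := codim_le_dependent (fun i : 'I_n.+1 => x ^+ i) idI In (ltnSn n).
pose p := rVpoly v.
have p0 : p != 0 by apply: contra v0 => /eqP p0; rewrite -[v]rVpolyK -/p p0 linear0.
have Ip : I (horner_alg x p).
  suff -> : horner_alg x p = \sum_i v 0 i *: x ^+ i by [].
  rewrite /p /rVpoly poly_def rmorph_sum; apply: eq_bigr => i _ /=.
  rewrite insubT //= => lti; rewrite -mul_polyC rmorphM rmorphXn /= horner_algC horner_algX.
  by rewrite mulr_algl; congr (v _ _ *: _); apply: val_inj.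
have [r pE] := closed_field_poly_normal p.
have lc0 : lead_coef p != 0 by rewrite lead_coef_eq0.
(* No root has multiplicity above the number of roots, so [size r] serves as a common exponent. *)
exists (undup r), (size r); split; first exact: undup_uniq.
have Ir : I (\prod_(z <- r) (x - z%:A)).
  rewrite pE -mul_polyC rmorphM /= horner_algC mulr_algl in Ip.
  rewrite rmorph_prod in Ip.
  rewrite -[X in I X]scale1r -(mulVf lc0) -scalerA; apply: idealZ => //.
  by under eq_bigr do rewrite -[X in X - _](horner_algX x) -(horner_algC x) -rmorphB.
rewrite -prodr_undup_exp_count in Ir.
have -> : \prod_(z <- undup r) (x - z%:A) ^+ size r =
    \prod_(z <- undup r) (x - z%:A) ^+ (size r - count_mem z r) *
    \prod_(z <- undup r) (x - z%:A) ^+ count_mem z r.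
  rewrite -big_split /=; apply: eq_bigr => z _.
  by rewrite -exprD subnK // count_size.
exact: idealMl.
Qed.

End Points.

Definition i0 : 'I_3 := @Ordinal 3 0 isT.
Definition i1 : 'I_3 := @Ordinal 3 1 isT.
Definition i2 : 'I_3 := @Ordinal 3 2 isT.

Lemma ord3P (P : 'I_3 -> Prop) : P i0 -> P i1 -> P i2 -> forall i, P i.
Proof.
move=> P0 P1 P2 [[|[|[|//]]] lti].
- by rewrite (_ : Ordinal _ = i0) //; apply: val_inj.
- by rewrite (_ : Ordinal _ = i1) //; apply: val_inj.
- by rewrite (_ : Ordinal _ = i2) //; apply: val_inj.
Qed.

Lemma big_ord3 (R : Type) (idx : R) (op : Monoid.law idx) (G : 'I_3 -> R) :
  \big[op/idx]_(i < 3) G i = op (G i0) (op (G i1) (G i2)).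
Proof.
rewrite !big_ord_recl big_ord0 Monoid.mulm1.
by congr (op _ (op _ _)); congr (G _); apply: val_inj.
Qed.

(** Stands in for localisation at $c$: for $m$ large, the quotient by this ideal is the local part
    of the quotient by $I$ at $c$. *)
Definition adjoin_powers (F : fieldType) (I : {mpoly F[3]} -> Prop) (c : 'I_3 -> F) m :=
  let y i := ('X_i - (c i)%:MP) ^+ m in
  adjoin (adjoin (adjoin I (y i0)) (y i1)) (y i2).

Lemma adjoin_powers_ideal (F : fieldType) (I : {mpoly F[3]} -> Prop) c m :
  is_ideal I -> is_ideal (adjoin_powers I c m).
Proof. by move=> idI; do 3!apply: adjoin_ideal. Qed.

Lemma adjoin_powers_sub (F : fieldType) (I : {mpoly F[3]} -> Prop) c m g :
  is_ideal I -> I g -> adjoin_powers I c m g.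
Proof. by move=> idI Ig; do 3!apply: adjoin_sub. Qed.

Lemma adjoin_powers_gen (F : fieldType) (I : {mpoly F[3]} -> Prop) c m i :
  is_ideal I -> adjoin_powers I c m (('X_i - (c i)%:MP) ^+ m).
Proof.
move=> idI; have id1 x := adjoin_ideal idI x.
have id2 x y := adjoin_ideal (id1 x) y.
elim/ord3P: i; [do 2!apply: adjoin_sub | apply: adjoin_sub |]; exact: adjoin_gen.
Qed.

(** The list is the grid of all triples of roots of annihilators of the three coordinates. It may
    contain points where no local part exists; the bound [n] is chosen afterwards and may be $0$
    there. *)
Lemma codim_le_points (F : closedFieldType) (I : {mpoly F[3]} -> Prop) N :
  is_ideal I -> codim_le I N ->
  exists (cs : seq (3.-tuple F)) (m : nat), uniq cs /\
    forall n : 3.-tuple F -> nat,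
    (forall c, c \in cs -> codim_le (adjoin_powers I (tnth c) m) (n c)) ->
    codim_le I (\sum_(c <- cs) n c).
Proof.
move=> idI IN.
have ann J i : is_ideal J -> (forall g, I g -> J g) ->
    exists (rs : seq F) (m : nat), uniq rs /\ J (\prod_(r <- rs) ('X_i - r%:MP) ^+ m).
  move=> idJ sub; have [rs [m [U H]]] := codim_le_annihilator 'X_i idJ (codim_le_sub sub IN).
  by exists rs, m; split=> //; under eq_bigr do rewrite -alg_mpolyC.
have [r0 [m0 [u0 H0]]] := ann I i0 idI (fun g Ig => Ig).
have [r1 [m1 [u1 H1]]] := ann I i1 idI (fun g Ig => Ig).
have [r2 [m2 [u2 H2]]] := ann I i2 idI (fun g Ig => Ig).
pose m := maxn m0 (maxn m1 m2).
have raise i rs k : (k <= m)%N -> I (\prod_(r <- rs) ('X_i - r%:MP) ^+ k) ->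
    I (\prod_(r <- rs) ('X_i - r%:MP) ^+ m).
  move=> lekm H; under eq_bigr do rewrite -(subnK lekm) exprD.
  by rewrite big_split /=; apply: idealMl.
have {}H0 := raise i0 r0 m0 (leq_maxl _ _) H0.
have {}H1 : I (\prod_(r <- r1) ('X_i1 - r%:MP) ^+ m) by apply: (raise _ _ m1); rewrite // /m; lia.
have {}H2 : I (\prod_(r <- r2) ('X_i2 - r%:MP) ^+ m) by apply: (raise _ _ m2); rewrite // /m; lia.
exists [seq [tuple ab.1; ab.2; c] | ab <- [seq (a, b) | a <- r0, b <- r1], c <- r2], m.
split.
  apply: allpairs_uniq => //; first by apply: allpairs_uniq => // -[a b] [a' b'].
  by move=> [[a b] c] [[a' b'] c'] _ _ /= [-> -> ->].
move=> n Hn.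
rewrite !big_allpairs_dep /=.
apply: (codim_le_prod_roots (x := 'X_i0) (m := m)) => //.
  by under eq_bigr do rewrite alg_mpolyC.
move=> a a_r0.
have id1 := adjoin_ideal idI (('X_i0 - a%:A) ^+ m).
apply: (codim_le_prod_roots (x := 'X_i1) (m := m)) => //.
  by apply: adjoin_sub; under eq_bigr do rewrite alg_mpolyC.
move=> b b_r1.
have id2 := adjoin_ideal id1 (('X_i1 - b%:A) ^+ m).
apply: (codim_le_prod_roots (x := 'X_i2) (m := m)) => //.
  by do 2!apply: adjoin_sub; under eq_bigr do rewrite alg_mpolyC.
move=> c c_r2; rewrite !alg_mpolyC.
have := Hn [tuple a; b; c]; rewrite /adjoin_powers !(tnth_nth 0) /=; apply.
apply/allpairsP; exists ((a, b), c); split=> //.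
by apply/allpairsP; exists (a, b).
Qed.

(** * Binary forms *)

Section BinaryForms.

Variable F : fieldType.
Implicit Types (P Q G : {poly F}).

Section Evaluation.

Variables (A : comAlgType F) (u w : A).

(* The binary form of degree j with dehomogenisation P, evaluated at (u, w). *)
Definition bform j P : A := \sum_(i < j.+1) P`_i *: (u ^+ i * w ^+ (j - i)).

Lemma bformZ j c P : bform j (c *: P) = c *: bform j P.
Proof. by rewrite /bform scaler_sumr; apply: eq_bigr => i _; rewrite coefZ scalerA. Qed.

Lemma bformD j P Q : bform j (P + Q) = bform j P + bform j Q.
Proof. by rewrite /bform -big_split /=; apply: eq_bigr => i _; rewrite coefD scalerDl. Qed.

Lemma bform0 j : bform j 0 = 0.
Proof. by rewrite /bform big1 // => i _; rewrite coef0 scale0r. Qed.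

Lemma bform_sum j (J : Type) (r : seq J) (p : pred J) (G : J -> {poly F}) :
  bform j (\sum_(i <- r | p i) G i) = \sum_(i <- r | p i) bform j (G i).
Proof.
rewrite /bform exchange_big; apply: eq_bigr => i _ /=.
by rewrite coef_sum scaler_suml.
Qed.

Lemma bformXn j k : (k <= j)%N -> bform j 'X^k = u ^+ k * w ^+ (j - k).
Proof.
move=> lekj; rewrite /bform (bigD1 (inord k)) //= inordK // coefXn eqxx scale1r.
rewrite big1 ?addr0 // => i ne; rewrite coefXn.
case: eqP => [eq_ik|]; last by rewrite scale0r.
by case/eqP: ne; rewrite -eq_ik inord_val.
Qed.

Lemma poly_sum_Xn j P : (size P <= j.+1)%N -> P = \sum_(i < j.+1) P`_i *: 'X^i.
Proof.
move=> sP; rewrite -(poly_def j.+1 (fun i => P`_i)); apply/polyP => k.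
by rewrite coef_poly; case: ltnP => // le_jk; rewrite nth_default // (leq_trans sP).
Qed.

Lemma rVpolyE n (v : 'rV[F]_n) : rVpoly v = \sum_i v 0 i *: 'X^i.
Proof.
rewrite /rVpoly poly_def; apply: eq_bigr => i _.
by rewrite insubT //= => lti; congr (v _ _ *: _); apply: val_inj.
Qed.

Lemma bformM i j P Q : (size P <= i.+1)%N -> (size Q <= j.+1)%N ->
  bform (i + j) (P * Q) = bform i P * bform j Q.
Proof.
move=> sP sQ; rewrite {1}(poly_sum_Xn sP) {1}(poly_sum_Xn sQ) mulr_suml bform_sum.
rewrite {2}/bform mulr_suml; apply: eq_bigr => a _.
rewrite mulr_sumr bform_sum {2}/bform mulr_sumr; apply: eq_bigr => b _.
rewrite -scalerAl -scalerAr !bformZ -exprD bformXn; last by have := ltn_ord a; have := ltn_ord b; lia.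
rewrite -scalerAl -scalerAr; congr (_ *: (_ *: _)).
have -> : (i + j - (a + b) = (i - a) + (j - b))%N by have := ltn_ord a; have := ltn_ord b; lia.
by rewrite !exprD; ring.
Qed.

Lemma bformXS j P : (size P <= j.+1)%N -> bform j.+1 ('X * P) = u * bform j P.
Proof.
move=> sP; rewrite -[j.+1]add1n bformM ?size_polyX //.
by rewrite -['X]expr1 bformXn // subnn mulr1.
Qed.

Lemma bformS j P : (size P <= j.+1)%N -> bform j.+1 P = w * bform j P.
Proof.
move=> sP; rewrite -[j.+1]add1n -[P in LHS]mul1r bformM ?size_poly1 //.
by rewrite -[1 in LHS](expr0 'X) bformXn // mul1r.
Qed.

Lemma bform0E P : (size P <= 1)%N -> bform 0 P = (P`_0)%:A.
Proof. by move=> _; rewrite /bform big_ord_recl big_ord0 addr0 mulr1. Qed.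

Lemma bform1E a b : bform 1 (a *: 'X + b%:P) = a *: u + b *: w.
Proof.
have := bformXn (leqnn 1); have := bformXn (leq0n 1).
rewrite !expr0 !expr1 mul1r mulr1 => e0 e1.
by rewrite -[b%:P]mulr1 mul_polyC bformD !bformZ e0 e1.
Qed.

End Evaluation.

(* Codimension in degree j of the ideal of two coprime binary forms of degree r;
   the truncated subtractions make it j + 1 for j < r and 0 for j >= 2r - 1. *)
Definition form_codim r j := (j.+1 - (j.+1 - r).*2)%N.

(** For $j<r$ the degrees $j$ and $r+j$ contribute $j+1$ and $r-1-j$, together $r$. The $m$ further
    degrees contribute nothing and allow a longer filtration. *)
Lemma sum_form_codim r m : (\sum_(j < r + r + m) form_codim r j = r * r)%N.
Proof.
rewrite !big_split_ord /= [X in (_ + X)%N]big1 ?addn0; last by move=> i _; rewrite /form_codim; lia.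
rewrite -big_split /= (eq_bigr (fun=> r)) ?sum_nat_const ?card_ord // => i _.
by rewrite /form_codim; have := ltn_ord i; lia.
Qed.

Section Coprime.

Variables (r : nat) (G1 G2 : {poly F}).
Hypotheses (sG1 : (size G1 <= r.+1)%N) (sG2 : (size G2 <= r.+1)%N).
Hypothesis cop : coprimep G1 G2.

(** The leading coefficient says that the form of [G1] does not vanish at infinity, so that coprime
    polynomials mean coprime forms; it also gives [G1] its full size for Euclidean division. *)
Lemma coprime_forms_span_lead j : G1`_r != 0 ->
  exists B : 'I_(form_codim r j) -> {poly F},
    forall P, (size P <= j.+1)%N -> exists e (a b : {poly F}),
      [/\ (size a <= j.+1 - r)%N, (size b <= j.+1 - r)%N &
          P = \sum_i e i *: B i + a * G1 + b * G2].
Proof.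
move=> G1r.
have szG1 : size G1 = r.+1.
  by apply/eqP; rewrite eqn_leq sG1 ltnNge; apply: contra G1r => /leq_sizeP/(_ r (leqnn r))/eqP.
have G10 : G1 != 0 by rewrite -size_poly_eq0 szG1.
case: (leqP (r.*2) j.+1) => [le_rj|lt_jr].
  (* Here [form_codim r j] is $0$. The coefficient of [G2] is reduced modulo [G1], after which the
     degree bound on the coefficient of [G1] is automatic. *)
  exists (fun=> 0) => P sP; case/Bezout_eq1_coprimepP: cop => -[u v] /= uv1.
  exists (fun=> 0); pose b : {poly F} := (P * v) %% G1; pose a : {poly F} := (P - b * G2) %/ G1.
  have sb : (size b <= r)%N by rewrite -ltnS -szG1 ltn_modp.
  have dv : G1 %| P - b * G2.
    have -> : P - b * G2 = P * (u * G1 + v * G2) - b * G2 by rewrite uv1 mulr1.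
    have -> : P * (u * G1 + v * G2) - b * G2 = (P * u + (P * v) %/ G1 * G2) * G1.
      have -> : P * (u * G1 + v * G2) = P * u * G1 + (P * v) * G2 by ring.
      by have := divp_eq (P * v) G1; rewrite -/b; move: (_ %/ _) (b) => q t ->; ring.
    exact: dvdp_mulIr.
  exists a, b; split.
  - rewrite size_divp // szG1 /= leq_sub2r //.
    rewrite (leq_trans (size_polyD _ _)) // geq_max sP size_polyN.
    rewrite (leq_trans (size_polyMleq _ _)) //; move: sb sG2 le_rj; rewrite -addnn; move: (size b) (size G2) => x y; lia.
  - by apply: leq_trans sb _; move: le_rj; rewrite -addnn; lia.
  by rewrite big1 ?add0r => [|i _]; rewrite ?scaler0 // divpK // subrK.
pose s := (j.+1 - r)%N.
have sXG G (i : 'I_s) : (size G <= r.+1)%N -> (size ('X^i * G)%R <= j.+1)%N.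
  move=> sG; rewrite (leq_trans (size_polyMleq _ _)) // size_polyXn.
  by have := ltn_ord i; rewrite /s; lia.
pose row_of (i : 'I_(s + s)) : 'rV[F]_j.+1 :=
  poly_rV (match split i with inl i => 'X^i * G1 | inr i => 'X^i * G2 end).
pose M := \matrix_i row_of i.
have MulM (v : 'rV_(s + s)) : exists a b : {poly F}, [/\ (size a <= s)%N, (size b <= s)%N,
    rVpoly (v *m M) = a * G1 + b * G2 & (a = 0 -> b = 0 -> v = 0)].
  exists (rVpoly (lsubmx v)), (rVpoly (rsubmx v)); split; try exact: size_poly.
    rewrite mulmx_sum_row linear_sum big_split_ord /= !rVpolyE !mulr_suml.
    congr (_ + _); apply: eq_bigr => i _; rewrite linearZ /= rowK /row_of mxE.
      have -> : split (lshift s i) = inl i := unsplitK (inl i).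
      by rewrite poly_rV_K ?sXG // scalerAl.
    have -> : split (rshift s i) = inr i := unsplitK (inr i).
    by rewrite poly_rV_K ?sXG // scalerAl.
  move=> a0 b0; rewrite -[v]hsubmxK -[lsubmx v]rVpolyK -[rsubmx v]rVpolyK a0 b0 !linear0.
  by rewrite row_mx0.
(* In these degrees there is no relation $aG_1+bG_2=0$: coprimality makes $G_1$ divide $b$, which is
   too short. A complement of the row space therefore has the stated dimension. *)
have freeM : row_free M.
  apply: inj_row_free => v vM; have [a [b [sa sb Eab v0]]] := MulM v.
  rewrite vM linear0 in Eab.
  have b0 : b = 0.
    apply/eqP; apply: contraTT isT => nz_b.
    have : G1 %| b.
      rewrite -(Gauss_dvdpl _ cop); apply/dvdpP; exists (- a).
      by apply/eqP; rewrite mulNr -addr_eq0 addrC -Eab.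
    by move/(dvdp_leq nz_b)/leq_trans/(_ sb); rewrite szG1 /s; move: lt_jr; rewrite -addnn; lia.
  apply: v0 => //; move/eqP: Eab; rewrite b0 mul0r addr0 eq_sym mulf_eq0 (negPf G10) orbF.
  by move/eqP.
have rkC : \rank (M^C)%MS = form_codim r j.
  by rewrite mxrank_compl (eqP freeM) /form_codim -addnn.
rewrite -rkC; exists (fun i => rVpoly (row i (row_base (M^C)%MS))) => P sP.
have /sub_addsmxP [[x y] /= E] : (poly_rV P <= M + row_base (M^C))%MS.
  by rewrite (adds_eqmx (eqmx_refl M) (eq_row_base _)); apply: submx_full; apply: addsmx_compl_full.
have [a [b [sa sb Eab _]]] := MulM x.
exists (fun i => y 0 i), a, b; split=> //.
rewrite -(poly_rV_K sP) E linearD /= Eab addrC -[RHS]addrA; congr (_ + _).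
by rewrite mulmx_sum_row linear_sum; apply: eq_bigr => i _; rewrite linearZ.
Qed.

End Coprime.

Lemma coprime_forms_span r G1 G2 j :
  (size G1 <= r.+1)%N -> (size G2 <= r.+1)%N -> coprimep G1 G2 ->
  (G1`_r != 0) || (G2`_r != 0) ->
  exists B : 'I_(form_codim r j) -> {poly F},
    forall P, (size P <= j.+1)%N -> exists e (a b : {poly F}),
      [/\ (size a <= j.+1 - r)%N, (size b <= j.+1 - r)%N &
          P = \sum_i e i *: B i + a * G1 + b * G2].
Proof.
move=> s1 s2 cop /orP [G1r|G2r]; first exact: coprime_forms_span_lead.
have [B HB] := coprime_forms_span_lead s2 s1 (etrans (coprimep_sym _ _) cop) j G2r.
exists B => P /HB [e [a [b [sa sb E]]]]; exists e, b, a; split=> //.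
by rewrite E -!addrA [X in _ + X]addrC.
Qed.

End BinaryForms.

(** * The local contribution of an ordinary singularity *)

Lemma mpoly_alg_ind n (R : nzRingType) (P : {mpoly R[n]} -> Prop) :
  (forall c, P c%:MP) -> (forall i, P 'X_i) ->
  (forall p q, P p -> P q -> P (p + q)) -> (forall p q, P p -> P q -> P (p * q)) ->
  forall p, P p.
Proof.
move=> PC PX PD PM; elim/mpolyind => [|c m p _ _ Pp]; first by rewrite -(mpolyC0 n).
apply: PD => //; rewrite -mul_mpolyC; apply: (PM) => //.
rewrite mpolyXE_id; elim/big_ind: _ => [|p1 p2|i _]; [by rewrite -(mpolyC1 n) | exact: (PM) |].
by elim: (m i) => [|k IH]; rewrite ?expr0 -?(mpolyC1 n) // exprS; apply: PM.
Qed.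

Lemma mderivXU n (R : nzRingType) (i l : 'I_n) : mderiv l 'X_i = (i == l)%:R :> {mpoly R[n]}.
Proof.
rewrite mderivX mnm1E; case: eqP => [->|_]; last by rewrite scale0r.
by rewrite scale1r -{1}[U_(l)%MM]add0m addmK mpolyX0.
Qed.

(** * The filtration by powers of $(u,w)$ in local coordinates at $c$ *)

Section LocalFiltration.

Variables (F : fieldType) (Q : {mpoly F[3]} -> Prop) (idQ : is_ideal Q).
Variables (c al be : 'I_3 -> F) (u w : {mpoly F[3]}).
Hypothesis coordQ : forall l, Q ('X_l - (c l)%:MP - (al l *: u + be l *: w)).
Implicit Types (g h : {mpoly F[3]}) (P : {poly F}).

(* Modulo Q, mpow j is the j-th power of the ideal (u, w). *)
Fixpoint mpow j g : Prop :=
  if j is j'.+1 then exists a b, [/\ mpow j' a, mpow j' b & Q (g - (a * u + b * w))]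
  else True.

Lemma mpow_Q j g : Q g -> mpow j g.
Proof.
elim: j g => //= j IH g Qg; exists 0, 0; rewrite !mul0r addr0 subr0.
by split=> //; apply: IH; apply: ideal0.
Qed.

Lemma mpow_ideal j : is_ideal (mpow j).
Proof.
split; first by apply: mpow_Q; apply: ideal0.
- elim: j => //= j IH g h [a [b [Ka Kb Qg]]] [a' [b' [Ka' Kb' Qh]]].
  exists (a + a'), (b + b'); split; try exact: IH.
  have -> : g + h - ((a + a') * u + (b + b') * w) =
    (g - (a * u + b * w)) + (h - (a' * u + b' * w)) by ring.
  exact: idealD.
elim: j => //= j IH g h [a [b [Ka Kb Qh]]].
exists (g * a), (g * b); split; try exact: IH.
have -> : g * h - (g * a * u + g * b * w) = g * (h - (a * u + b * w)) by ring.
exact: idealMl.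
Qed.

Lemma mpow_congr j g h : Q (g - h) -> mpow j h -> mpow j g.
Proof. by move=> Qgh; apply: (ideal_congr (mpow_ideal j)); apply: mpow_Q. Qed.

Lemma mpowS j g : mpow j.+1 g -> mpow j g.
Proof.
move=> [a [b [Ka Kb Qg]]]; apply: (mpow_congr Qg).
by apply: (idealD (mpow_ideal j)); apply: (idealMr (mpow_ideal j)).
Qed.

Lemma mpow_leq i j g : (i <= j)%N -> mpow j g -> mpow i g.
Proof.
elim: j => [|j IH]; first by rewrite leqn0 => /eqP ->.
by rewrite leq_eqVlt ltnS => /orP [/eqP -> //|/IH H /mpowS].
Qed.

Lemma mpowM i j g h : mpow i g -> mpow j h -> mpow (i + j) (g * h).
Proof.
elim: i g => [|i IH] g; first by move=> _; apply: (idealMl (mpow_ideal j)).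
move=> [a [b [Ka Kb Qg]]] Kh; exists (a * h), (b * h); split; try exact: IH.
have -> : g * h - (a * h * u + b * h * w) = h * (g - (a * u + b * w)) by ring.
exact: idealMl.
Qed.

Lemma mpow1u : mpow 1 u.
Proof. by exists 1, 0; split=> //; rewrite mul1r mul0r addr0 subrr; apply: ideal0. Qed.

Lemma mpow1w : mpow 1 w.
Proof. by exists 0, 1; split=> //; rewrite mul1r mul0r add0r subrr; apply: ideal0. Qed.

Lemma mpow_nil k g : Q (u ^+ k) -> Q (w ^+ k) -> mpow (k + k) g -> Q g.
Proof.
move=> Qu Qw Kg.
(* Strengthened for induction: each unfolding of [mpow] moves one factor $u$ or $w$ into the
   monomial, and at total degree $2k$ one exponent has reached $k$. *)
suff H j a b h : (k + k <= a + b + j)%N -> mpow j h -> Q (u ^+ a * w ^+ b * h).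
  by have := H _ 0%N 0%N _ (leqnn _) Kg; rewrite !expr0 !mul1r.
elim: j a b h => [|j IH] a b h le.
  move=> _; apply: idealMr => //; case: (leqP k a) => [ka|ka].
    by rewrite -(subnK ka) exprD; apply: (idealMr idQ); apply: (idealMl idQ).
  have kb : (k <= b)%N by lia.
  by rewrite -(subnK kb) exprD; do 2!apply: (idealMl idQ).
move=> [x [y [Kx Ky Qh]]]; apply: (ideal_congr idQ (y := u ^+ a * w ^+ b * (x * u + y * w))).
  by rewrite -mulrBr; apply: idealMl.
have -> : u ^+ a * w ^+ b * (x * u + y * w) =
  u ^+ a.+1 * w ^+ b * x + u ^+ a * w ^+ b.+1 * y by rewrite !exprS; ring.
by apply: idealD => //; apply: IH => //; lia.
Qed.

Lemma mpow_bform j P : mpow j (bform u w j P).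
Proof.
apply: (ideal_sum (mpow_ideal j)) => i _; apply: (idealZ (mpow_ideal j)).
have powK x n : mpow 1 x -> mpow n (x ^+ n).
  by move=> Kx; elim: n => // n IH; rewrite exprS -[n.+1]add1n; apply: mpowM.
rewrite -{1}(subnKC (ltn_ord i : (i <= j)%N)).
by apply: mpowM; apply: powK; [apply: mpow1u | apply: mpow1w].
Qed.

Lemma mpow_coord l : mpow 1 ('X_l - (c l)%:MP).
Proof.
by exists (al l)%:MP, (be l)%:MP; split=> //; rewrite !mul_mpolyC.
Qed.

Lemma mpow_eval g : mpow 1 (g - (g.@[c])%:MP).
Proof.
have id1 := mpow_ideal 1.
elim/mpoly_alg_ind: g => [a|i|p q Kp Kq|p q Kp Kq].
- by rewrite mevalC subrr; apply: (ideal0 id1).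
- by rewrite mevalXU; apply: mpow_coord.
- rewrite mevalD mpolyCD.
  have -> : p + q - (p.@[c]%:MP + q.@[c]%:MP) = (p - p.@[c]%:MP) + (q - q.@[c]%:MP) by ring.
  exact: (idealD id1).
- rewrite mevalM mpolyCM.
  have -> : p * q - p.@[c]%:MP * q.@[c]%:MP =
     (p - p.@[c]%:MP) * q + p.@[c]%:MP * (q - q.@[c]%:MP) by ring.
  by apply: (idealD id1); [apply: (idealMr id1) | apply: (idealMl id1)].
Qed.

(** First-order Taylor expansion. For a product, the new error is the product of two differences
    $p-p(c)$ and $q-q(c)$, each of order one. *)
Lemma mpow_taylor g :
  mpow 2 (g - (g.@[c])%:MP - \sum_l (mderiv l g).@[c] *: ('X_l - (c l)%:MP)).
Proof.
have id2 := mpow_ideal 2.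
elim/mpoly_alg_ind: g => [a|i|p q Kp Kq|p q Kp Kq].
- rewrite mevalC subrr big1 ?subrr; first exact: (ideal0 id2).
  by move=> l _; rewrite mderivC meval0 scale0r.
- rewrite mevalXU (bigD1 i) //= big1 => [|l ne].
    rewrite mderivXU eqxx meval1 scale1r addr0 subrr.
    exact: (ideal0 id2).
  by rewrite mderivXU eq_sym (negPf ne) meval0 scale0r.
- rewrite mevalD mpolyCD.
  under eq_bigr do rewrite mderivD mevalD scalerDl.
  rewrite big_split /=; set sp := \sum_l _ in Kp *; set sq := \sum_l _ in Kq *.
  have -> : p + q - (p.@[c]%:MP + q.@[c]%:MP) - (sp + sq) =
    (p - p.@[c]%:MP - sp) + (q - q.@[c]%:MP - sq) by ring.
  exact: (idealD id2).
- rewrite mevalM mpolyCM.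
  under eq_bigr do rewrite mderivM mevalD !mevalM scalerDl mulrC -!scalerA.
  rewrite big_split /= -!scaler_sumr -!mul_mpolyC.
  set sp := \sum_l _ in Kp *; set sq := \sum_l _ in Kq *.
  have -> : p * q - p.@[c]%:MP * q.@[c]%:MP - (q.@[c]%:MP * sp + p.@[c]%:MP * sq) =
    (p - p.@[c]%:MP) * (q - q.@[c]%:MP) + (q.@[c]%:MP * (p - p.@[c]%:MP - sp) +
     p.@[c]%:MP * (q - q.@[c]%:MP - sq)) by ring.
  apply: (idealD id2); first by apply: (@mpowM 1 1); apply: mpow_eval.
  by apply: (idealD id2); apply: (idealMl id2).
Qed.

(** A candidate initial form in degree $j$: [P] may be zero, and [g] need not determine it, since a
    nonzero form of degree $j$ can lie deeper in the filtration modulo $Q$. *)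
Definition initform j g P := (size P <= j.+1)%N /\ mpow j.+1 (g - bform u w j P).

Lemma initform_mpow j g P : initform j g P -> mpow j g.
Proof. by case=> _ /mpowS K; apply: (ideal_congr (mpow_ideal j) K); apply: mpow_bform. Qed.

Lemma initform0 g : initform 0 g (g.@[c])%:P.
Proof.
split; first by rewrite size_polyC; case: eqP.
by rewrite bform0E ?size_polyC ?coefC ?alg_mpolyC; [apply: mpow_eval | case: eqP].
Qed.

Lemma initformM i j g h P P' : initform i g P -> initform j h P' -> initform (i + j) (g * h) (P * P').
Proof.
move=> iP iP'; have Kh := initform_mpow iP'; case: iP iP' => sP Kg [sP' Kh'].
split.
  by rewrite (leq_trans (size_polyMleq _ _)) //; move: (size P) (size P') sP sP' => a b; lia.
rewrite bformM //; set x := bform _ _ _ _ in Kg *; set y := bform _ _ _ _ in Kh' *.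
have -> : g * h - x * y = (g - x) * h + x * (h - y) by ring.
apply: (idealD (mpow_ideal _)); first by rewrite -addSn; apply: mpowM.
by rewrite -addnS; apply: mpowM => //; apply: mpow_bform.
Qed.

Lemma initformD j g h P P' : initform j g P -> initform j h P' -> initform j (g + h) (P + P').
Proof.
move=> [sP Kg] [sP' Kh]; split.
  by rewrite (leq_trans (size_polyD _ _)) // geq_max sP.
rewrite bformD; set x := bform _ _ _ _ in Kg *; set y := bform _ _ _ _ in Kh *.
have -> : g + h - (x + y) = (g - x) + (h - y) by ring.
exact: (idealD (mpow_ideal _)).
Qed.

Lemma initform_mpowS j g : mpow j.+1 g -> initform j g 0.
Proof.
move=> Kg; split; first by rewrite size_poly0.
by rewrite bform0 subr0.
Qed.

Lemma initform_sum j (T : Type) (r : seq T) (p : pred T) (g : T -> {mpoly F[3]}) (P : T -> {poly F}) :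
  (forall i, p i -> initform j (g i) (P i)) ->
  initform j (\sum_(i <- r | p i) g i) (\sum_(i <- r | p i) P i).
Proof.
move=> H; elim/big_ind2: _ => //; last by move=> x1 x2 y1 y2; apply: initformD.
by apply: initform_mpowS; apply: (ideal0 (mpow_ideal _)).
Qed.

Lemma initform_prod (T : finType) (Z : {set T}) (g : T -> {mpoly F[3]}) (P : T -> {poly F}) :
  (forall i, i \in Z -> initform 1 (g i) (P i)) ->
  initform #|Z| (\prod_(i in Z) g i) (\prod_(i in Z) P i).
Proof.
rewrite -![\prod_(i in Z) _]big_enum cardE => H.
have {H} : forall i, i \in enum Z -> initform 1 (g i) (P i) by move=> i; rewrite mem_enum; apply: H.
elim: (enum Z) => [|i s IH] H.
  by rewrite !big_nil; have := initform0 1; rewrite meval1.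
rewrite !big_cons -[size _]add1n; apply: initformM; first by apply: H; rewrite mem_head.
by apply: IH => k ks; apply: H; rewrite inE ks orbT.
Qed.

Lemma initform1_vanishing g : g.@[c] = 0 ->
  initform 1 g ((\sum_l al l * (mderiv l g).@[c]) *: 'X + (\sum_l be l * (mderiv l g).@[c])%:P).
Proof.
move=> gc; split.
  rewrite (leq_trans (size_polyD _ _)) // geq_max (leq_trans (size_scale_leq _ _)) ?size_polyX //.
  by rewrite size_polyC; case: eqP.
rewrite bform1E; have := mpow_taylor g; rewrite gc subr0.
apply: (ideal_congr (mpow_ideal 2)); apply: mpow_Q.
set s := \sum_l _ *: ('X_l - _); set t := _ *: u + _.
have -> : g - t - (g - s) = s - t by ring.
have -> : s - t = \sum_l (mderiv l g).@[c] *: ('X_l - (c l)%:MP - (al l *: u + be l *: w)).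
  rewrite /t !scaler_suml -big_split /= -sumrB; apply: eq_bigr => l _.
  by rewrite [RHS]scalerBr [_ *: (al l *: u + _)]scalerDr !scalerA [al l * _]mulrC [be l * _]mulrC.
by apply: ideal_sum => // l _; apply: idealZ.
Qed.

Lemma mpow_initform j g : mpow j g -> exists P, initform j g P.
Proof.
elim: j g => [|j IH] g; first by move=> _; exists (g.@[c])%:P; apply: initform0.
move=> [a [b [/IH [A iA] /IH [B iB] Qg]]].
case: (iA) (iB) => sA Ka [sB Kb]; exists ('X * A + B); split.
  rewrite (leq_trans (size_polyD _ _)) // geq_max (leq_trans (size_polyMleq _ _)) ?size_polyX //=.
  exact: leqW.
rewrite bformD bformXS // bformS //; apply: (mpow_congr (h := (a - bform u w j A) * u + (b - bform u w j B) * w)).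
  set x := bform _ _ _ _; set y := bform _ _ _ _.
  by have -> : g - (u * x + w * y) - ((a - x) * u + (b - y) * w) = g - (a * u + b * w) by ring.
by exists (a - bform u w j A), (b - bform u w j B); split=> //; rewrite subrr; apply: ideal0.
Qed.

(** Multiples of $G_1$ and $G_2$ drop to the next layer, so layer $j$ needs only [form_codim r j]
    generators, and these sum to $r^2$. *)
Lemma local_codim k r (G1 G2 : {poly F}) :
  Q (u ^+ k) -> Q (w ^+ k) ->
  (size G1 <= r.+1)%N -> (size G2 <= r.+1)%N -> coprimep G1 G2 ->
  (G1`_r != 0) || (G2`_r != 0) ->
  mpow r.+1 (bform u w r G1) -> mpow r.+1 (bform u w r G2) -> codim_le Q (r * r).
Proof.
move=> Qu Qw s1 s2 cop lead K1 K2.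
have KG j (a G : {poly F}) : (size a <= j.+1 - r)%N -> (size G <= r.+1)%N ->
    mpow r.+1 (bform u w r G) -> mpow j.+1 (bform u w j (a * G)).
  move=> sa sG KG; case: (leqP r j) => [le_rj|lt_jr].
    have -> : bform u w j (a * G) = bform u w (j - r) a * bform u w r G.
      by rewrite -bformM ?subnK // -subSn.
    have -> : j.+1 = (j - r + r.+1)%N by lia.
    by apply: mpowM => //; apply: mpow_bform.
  move: sa; have -> : (j.+1 - r = 0)%N by lia.
  rewrite leqn0 size_poly_eq0 => /eqP ->; rewrite mul0r bform0.
  exact: (ideal0 (mpow_ideal _)).
(* The padding by $2k$ lets the filtration run until [mpow_nil] puts its last layer inside $Q$. *)
rewrite -(sum_form_codim r (k + k)).
apply: (codim_le_filtration (K := mpow)) => //.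
- by move=> g; exists g => //; rewrite subrr; apply: ideal0.
- by move=> g /mpow_leq Kg; apply: (mpow_nil Qu Qw); apply: Kg; lia.
move=> j _; have [B HB] := coprime_forms_span j s1 s2 cop lead.
exists (fun i => bform u w j (B i)) => g /mpow_initform [P [sP KP]].
have [e [a [b [sa sb E]]]] := HB P sP; exists e.
exists (g - \sum_i e i *: bform u w j (B i)); last by rewrite subrr; apply: ideal0.
move: KP; rewrite E !bformD bform_sum; under eq_bigr do rewrite bformZ.
set s := \sum_i _; set x := bform _ _ _ _; set y := bform _ _ _ _ => KP.
have -> : g - s = (g - (s + x + y)) + (x + y) by ring.
apply: (idealD (mpow_ideal _)) => //.
by apply: (idealD (mpow_ideal _)); apply: KG.
Qed.

End LocalFiltration.

(** * Coprimality of the two derivatives of a product of linear forms *)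

Section DerivativesOfLinearProducts.

Variables (F : numClosedFieldType) (T : finType) (Z : {set T}).

Lemma sum_cofactor_zero (R : comNzRingType) (L D : T -> R) i : i \in Z -> L i = 0 ->
  \sum_(k in Z) D k * \prod_(j in Z :\ k) L j = D i * \prod_(j in Z :\ i) L j.
Proof.
move=> iZ Li; rewrite (bigD1 i) //= [X in _ + X]big1 ?addr0 // => k /andP [kZ ki].
by rewrite (bigD1 i) /= ?Li ?mul0r ?mulr0 // !inE iZ eq_sym ki.
Qed.

Lemma sum_cofactor_diag (R : comNzRingType) (L : T -> R) :
  \sum_(k in Z) L k * \prod_(j in Z :\ k) L j = (\prod_(j in Z) L j) *+ #|Z|.
Proof.
rewrite -sumr_const; apply: eq_bigr => k kZ; rewrite [RHS](bigD1 k) //=; congr (_ * _).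
by apply: eq_bigl => j; rewrite !inE andbC.
Qed.

Variables A B : T -> F.
Hypothesis nzAB : forall i, i \in Z -> (A i != 0) || (B i != 0).
Hypothesis detAB : forall i j, i \in Z -> j \in Z -> i != j -> A i * B j != A j * B i.
Hypothesis Z0 : Z != set0.

(** For $D=A$ and $D=B$ these are the dehomogenised partial derivatives of $\prod_j(A_ju+B_jw)$ in
    $u$ and in $w$. *)
Definition cofactor_form (D : T -> F) : {poly F} :=
  \sum_(i in Z) D i *: \prod_(j in Z :\ i) (A j *: 'X + (B j)%:P).

Let L s j := A j * s + B j.

Lemma cofactor_form_eval D s :
  (cofactor_form D).[s] = \sum_(i in Z) D i * \prod_(j in Z :\ i) L s j.
Proof.
rewrite /cofactor_form horner_sum; apply: eq_bigr => i _.
rewrite hornerZ horner_prod; congr (_ * _); apply: eq_bigr => j _.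
by rewrite hornerD hornerZ hornerX hornerC.
Qed.

Lemma coef_prod_linear (Y : {set T}) :
  (size (\prod_(j in Y) (A j *: 'X + (B j)%:P))%R <= #|Y|.+1)%N /\
  (\prod_(j in Y) (A j *: 'X + (B j)%:P))`_#|Y| = \prod_(j in Y) A j.
Proof.
rewrite -![\prod_(j in Y) _]big_enum cardE.
elim: (enum Y) => [|i s [IHs IHc]]; first by rewrite !big_nil size_poly1 coef1.
rewrite !big_cons /=; set p := \prod_(j <- s) _ in IHs IHc *.
have -> : (A i *: 'X + (B i)%:P) * p = A i *: ('X * p) + B i *: p.
  by rewrite -!mul_polyC; ring.
split.
  rewrite (leq_trans (size_polyD _ _)) // geq_max.
  rewrite !(leq_trans (size_scale_leq _ _)) //= ?(leq_trans IHs) //.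
  by rewrite (leq_trans (size_polyMleq _ _)) // size_polyX.
by rewrite coefD !coefZ coefXM /= IHc [p`__]nth_default // mulr0 addr0.
Qed.

Lemma cofactor_form_lead D :
  (cofactor_form D)`_(#|Z|.-1) = \sum_(i in Z) D i * \prod_(j in Z :\ i) A j.
Proof.
rewrite /cofactor_form coef_sum; apply: eq_bigr => i iZ; rewrite coefZ; congr (_ * _).
by have [_ <-] := coef_prod_linear (Z :\ i); rewrite [#|Z|](cardsD1 i) iZ.
Qed.

Lemma prod_eq0_mem (L' : T -> F) : \prod_(j in Z) L' j = 0 -> exists2 i, i \in Z & L' i = 0.
Proof. by move/eqP/prodf_eq0 => [i iZ /eqP]; exists i. Qed.

(** Coprimality at the point at infinity: if both leading coefficients vanish, then $|Z|\prod A_j=0$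
    gives some $A_i=0$, and the second one becomes $B_i\prod_{j\ne i}A_j$, which is nonzero. *)
Lemma cofactor_form_lead_neq0 :
  ((cofactor_form A)`_(#|Z|.-1) != 0) || ((cofactor_form B)`_(#|Z|.-1) != 0).
Proof.
rewrite -negb_and; apply/negP => /andP [/eqP A0 /eqP B0].
move: A0; rewrite cofactor_form_lead sum_cofactor_diag => /eqP.
rewrite mulrn_eq0 cards_eq0 (negPf Z0) /= => /eqP/prod_eq0_mem [i iZ Ai].
move: B0; rewrite cofactor_form_lead (sum_cofactor_zero _ iZ Ai) => /eqP.
rewrite mulf_eq0 => /orP [/eqP Bi|].
  by have := nzAB iZ; rewrite Ai Bi eqxx.
move/prodf_eq0 => [j]; rewrite !inE => /andP [ji jZ] /eqP Aj.
by have := detAB iZ jZ; rewrite eq_sym ji Ai Aj !mul0r eqxx => /(_ isT).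
Qed.

(** By Euler's formula a common zero is a zero of the product, hence of one factor $L_i$. There the
    derivatives are $A_i$ and $B_i$ times the other factors, which are nonzero because the forms are
    pairwise independent. *)
Lemma cofactor_form_coprime : coprimep (cofactor_form A) (cofactor_form B).
Proof.
apply/Pdiv.ClosedField.coprimepP => s; rewrite rootE => /eqP A0; apply/negP => /eqP B0.
have : s * (cofactor_form A).[s] + (cofactor_form B).[s] = 0.
  by rewrite A0 B0 mulr0 addr0.
have -> : s * (cofactor_form A).[s] + (cofactor_form B).[s] = (\prod_(j in Z) L s j) *+ #|Z|.
  rewrite -sum_cofactor_diag !cofactor_form_eval mulr_sumr -big_split /=.
  by apply: eq_bigr => i _; rewrite /L; ring.
move/eqP; rewrite mulrn_eq0 cards_eq0 (negPf Z0) /= => /eqP/prod_eq0_mem [i iZ Li].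
move: A0 B0; rewrite !cofactor_form_eval !(sum_cofactor_zero _ iZ Li) => /eqP A0 /eqP B0.
have nz : \prod_(j in Z :\ i) L s j != 0.
  apply/prodf_neq0 => j; rewrite !inE => /andP [ji jZ]; apply/eqP => Lj.
  have := detAB iZ jZ; rewrite eq_sym ji => /(_ isT)/eqP; apply.
  have -> : B j = - (A j * s) by apply/eqP; rewrite -addr_eq0 addrC; apply/eqP.
  have -> : B i = - (A i * s) by apply/eqP; rewrite -addr_eq0 addrC; apply/eqP.
  by ring.
move: A0 B0; rewrite !mulf_eq0 (negPf nz) !orbF => A0 B0.
by have := nzAB iZ; rewrite A0 B0.
Qed.

End DerivativesOfLinearProducts.

Lemma mderiv_prod n (R : comNzRingType) (T : finType) (f : T -> {mpoly R[n]}) l :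
  mderiv l (\prod_i f i) = \sum_i mderiv l (f i) * \prod_(j | j != i) f j.
Proof.
suff H r : uniq r -> mderiv l (\prod_(i <- r) f i) =
    \sum_(i <- r) mderiv l (f i) * \prod_(j <- r | j != i) f j by apply: H; apply: index_enum_uniq.
elim: r => [|a r IH] /=; first by rewrite !big_nil mderivC.
case/andP => ar /IH {}IH; rewrite big_cons mderivM IH [in RHS]big_cons; congr (_ + _).
  congr (_ * _); rewrite big_cons eqxx /= [in RHS]big_seq_cond [in LHS]big_seq.
  by apply: eq_bigl => j; case: eqP => [->|]; rewrite ?(negPf ar) ?andbT.
rewrite mulr_sumr big_seq [RHS]big_seq; apply: eq_bigr => i ir.
rewrite [in RHS]big_cons (_ : a != i); last by apply: contra ar => /eqP ->.
by rewrite mulrCA.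
Qed.

(** * Initial forms of the derivatives of the product at a point of the curve *)

Section LocalCurves.

Variables (F : numClosedFieldType) (Q : {mpoly F[3]} -> Prop) (idQ : is_ideal Q).
Variables (c al be : 'I_3 -> F) (u w : {mpoly F[3]}).
Hypothesis coordQ : forall l, Q ('X_l - (c l)%:MP - (al l *: u + be l *: w)).
Variables (k : nat) (fs : 'I_k -> {mpoly F[3]}).

Let Z := [set i | (fs i).@[c] == 0].
Definition dird (ga : 'I_3 -> F) (g : {mpoly F[3]}) : F := \sum_l ga l * (mderiv l g).@[c].
Let A i := dird al (fs i).
Let B i := dird be (fs i).

(** In the product rule, a term that differentiates a curve through $c$ keeps $|Z|-1$ vanishing
    factors, and the curves off $c$ contribute the constant. The other terms keep all $|Z|$
    vanishing factors and are of higher order. *)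
Lemma initform_dird_prod ga : Z != set0 ->
  initform Q u w (#|Z|.-1) (\sum_l ga l *: mderiv l (\prod_i fs i))
    ((\prod_(j in ~: Z) (fs j).@[c]) *: cofactor_form Z A B (fun i => dird ga (fs i))).
Proof.
move=> Z0; have Zgt0 : (0 < #|Z|)%N by rewrite card_gt0.
have -> : \sum_l ga l *: mderiv l (\prod_i fs i) =
    \sum_i (\sum_l ga l *: mderiv l (fs i)) * \prod_(j | j != i) fs j.
  under [LHS]eq_bigr => l _ do rewrite mderiv_prod scaler_sumr.
  rewrite exchange_big /=; apply: eq_bigr => i _.
  by rewrite mulr_suml; apply: eq_bigr => l _; rewrite scalerAl.
have initZ i : i \in Z -> initform Q u w 1 (fs i) (A i *: 'X + (B i)%:P).
  by rewrite inE => /eqP fc; apply: initform1_vanishing.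
rewrite (bigID (mem Z)) /= -[X in initform _ _ _ _ _ X]addr0; apply: initformD => //.
  rewrite /cofactor_form scaler_sumr; apply: initform_sum => // i iZ.
  have -> : \prod_(j | j != i) fs j = \prod_(j in Z :\ i) fs j * \prod_(j in ~: Z) fs j.
    rewrite (bigID (mem Z)) /=; congr (_ * _); apply: eq_bigl => j; rewrite !inE //.
    by case: eqP => [->|//]; move: iZ; rewrite inE => ->.
  have i0 := initform0 idQ coordQ (\sum_l ga l *: mderiv l (fs i)).
  have i1 : initform Q u w #|Z|.-1 (\prod_(j in Z :\ i) fs j)
                (\prod_(j in Z :\ i) (A j *: 'X + (B j)%:P)).
    have -> : #|Z|.-1 = #|Z :\ i| by rewrite [#|Z|](cardsD1 i) iZ.
    by apply: initform_prod => // j; rewrite in_setD1 => /andP [_ /initZ].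
  have i2 := initform0 idQ coordQ (\prod_(j in ~: Z) fs j).
  have := initformM idQ i0 (initformM idQ i1 i2); rewrite add0n addn0.
  have -> : (\sum_l ga l *: mderiv l (fs i)).@[c] = dird ga (fs i).
    by rewrite raddf_sum; apply: eq_bigr => l _; rewrite /= mevalZ.
  rewrite (rmorph_prod (meval c)) /= -!mul_polyC.
  by congr (initform _ _ _ _ _ _); ring.
apply: initform_mpowS; apply: (ideal_sum (mpow_ideal idQ u w _)) => i iZ.
rewrite prednK // (bigID (mem Z)) /= mulrCA mulrC.
have -> : \prod_(j | (j != i) && (j \in Z)) fs j = \prod_(j in Z) fs j.
  by apply: eq_bigl => j; case: eqP => [->|//]; rewrite (negPf iZ).
apply: (idealMl (mpow_ideal idQ u w _)).
by apply: initform_mpow (initform_prod _ _ _) => //; apply: initZ.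
Qed.

Lemma local_codim_curves m :
  Q (u ^+ m) -> Q (w ^+ m) -> Z != set0 ->
  (forall i, i \in Z -> (A i != 0) || (B i != 0)) ->
  (forall i j, i \in Z -> j \in Z -> i != j -> A i * B j != A j * B i) ->
  (forall l, Q (mderiv l (\prod_i fs i))) ->
  codim_le Q (#|Z|.-1 * #|Z|.-1).
Proof.
move=> Qu Qw Z0 nzAB detAB Qd.
pose ka := \prod_(j in ~: Z) (fs j).@[c].
have ka0 : ka != 0 by apply/prodf_neq0 => j; rewrite !inE.
(* The derivatives belong to $Q$, which lies in every layer, so their initial forms fall one layer
   deeper. *)
have H ga : (size (ka *: cofactor_form Z A B (fun i => dird ga (fs i)))%R <= #|Z|.-1.+1)%N /\
    mpow Q u w #|Z|.-1.+1 (bform u w #|Z|.-1 (ka *: cofactor_form Z A B (fun i => dird ga (fs i)))).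
  have [s K] := initform_dird_prod ga Z0; split=> //.
  set G := bform _ _ _ _ in K *; set d := \sum_l _ in K.
  have -> : G = d - (d - G) by ring.
  apply: (idealB (mpow_ideal idQ _ _ _)) => //; apply: mpow_Q => //.
  by apply: ideal_sum => // l _; apply: idealZ.
have [s1 K1] := H al; have [s2 K2] := H be.
apply: (local_codim idQ coordQ Qu Qw s1 s2) => //.
- by rewrite coprimepZl // coprimepZr //; apply: cofactor_form_coprime.
by rewrite !coefZ !mulf_eq0 (negPf ka0) /=; apply: cofactor_form_lead_neq0.
Qed.

End LocalCurves.

(** * Homogeneous polynomials and restriction to a line *)

Section Homogeneous.

Variables (n : nat) (R : comNzRingType).
Implicit Types (p q : {mpoly R[n]}).

Lemma homog_ind (P : nat -> {mpoly R[n]} -> Prop) :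
  (forall d, P d 0) -> P 0%N 1 -> (forall i, P 1%N 'X_i) ->
  (forall d c p, P d p -> P d (c *: p)) ->
  (forall d p q, P d p -> P d q -> P d (p + q)) ->
  (forall d e p q, P d p -> P e q -> P (d + e)%N (p * q)) ->
  forall d p, p \is d.-homog -> P d p.
Proof.
move=> P0 P1 PX PZ PD PM d p /dhomogP hp; rewrite [p]mpolyE big_seq.
apply: (big_ind (P d)) => // [x y|m /hp <-]; first exact: (PD).
apply: (PZ); rewrite mpolyXE_id /= mdegE; apply: (big_ind2 (fun p d => P d p)) => //.
  by move=> x1 x2 y1 y2; apply: (PM).
move=> i _; elim: (m i) => [|k IH]; first by rewrite expr0.
by rewrite exprS -[k.+1]add1n; apply: (PM).
Qed.

Lemma euler_homog d p : p \is d.-homog -> \sum_l 'X_l * mderiv l p = p *+ d.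
Proof.
elim/homog_ind: d p / => [d||i|d c p IH|d p q IHp IHq|d e p q IHp IHq].
- by rewrite mul0rn big1 // => l _; rewrite mderiv0 mulr0.
- by rewrite mulr0n big1 // => l _; rewrite mderivC mulr0.
- rewrite (bigD1 i) //= big1 => [|l ne].
    by rewrite mderivXU eqxx mulr1 addr0.
  by rewrite mderivXU eq_sym (negPf ne) mulr0.
- under eq_bigr do rewrite mderivZ -scalerAr.
  by rewrite -scaler_sumr IH scalerMnr.
- under eq_bigr do rewrite mderivD mulrDr.
  by rewrite big_split /= IHp IHq mulrnDl.
- rewrite (eq_bigr (fun l => 'X_l * mderiv l p * q + p * ('X_l * mderiv l q))); last first.
    by move=> l _; rewrite mderivM; ring.
  by rewrite big_split /= -mulr_suml -mulr_sumr IHp IHq mulrnDr mulrnAl mulrnAr.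
Qed.

Lemma euler_eval d p (v : 'I_n -> R) : p \is d.-homog ->
  \sum_l v l * (mderiv l p).@[v] = p.@[v] *+ d.
Proof.
move=> hp; rewrite -mevalMn -(euler_homog hp) raddf_sum; apply: eq_bigr => l _ /=.
by rewrite mevalM mevalXU.
Qed.

Lemma mderiv_homog d p l : p \is d.+1.-homog -> mderiv l p \is d.-homog.
Proof.
move=> /dhomogP hp; apply/dhomogP => m; rewrite mcoeff_msupp mcoeff_mderiv => nz.
have : (m + U_(l))%MM \in msupp p.
  by rewrite mcoeff_msupp; apply: contraNneq nz => ->; rewrite mul0rn.
by move/hp; rewrite /= mdegD mdeg1 addn1 => -[].
Qed.

Notation pih := (pihomog (@mdeg n)).

Lemma pihomogM d e p q : p \is d.-homog -> pih (d + e) (p * q) = p * pih e q.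
Proof.
move=> hp; rewrite {1}(pihomog_partitionE (leqnn (msize q))) mulr_sumr raddf_sum /=.
have [lt_e|ge_e] := ltnP e (msize q).
  rewrite (bigD1 (Ordinal lt_e)) //= pihomog_dE; last by apply: dhomogM => //; apply: pihomogP.
  rewrite big1 ?addr0 // => i ne; apply: (@pihomog_ne0 _ _ _ (d + i)); last first.
    by apply: dhomogM => //; apply: pihomogP.
  by rewrite eqn_add2l; apply: contra ne => /eqP ei; apply/eqP/val_inj.
rewrite big1 => [|i _]; last first.
  apply: (@pihomog_ne0 _ _ _ (d + i)); last by apply: dhomogM => //; apply: pihomogP.
  by rewrite eqn_add2l neq_ltn (leq_trans (ltn_ord i)).
rewrite pihomogE big_seq_cond big1 ?mulr0 // => m /andP [/msize_mdeg_lt lt_m /eqP me].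
by move: lt_m; rewrite me ltnNge ge_e.
Qed.

Lemma pihomogM_lt d e p q : p \is d.-homog -> (e < d)%N -> pih e (p * q) = 0.
Proof.
move=> hp lt_ed; rewrite {1}(pihomog_partitionE (leqnn (msize q))) mulr_sumr raddf_sum /=.
apply: big1 => i _; apply: (@pihomog_ne0 _ _ _ (d + i)); last by apply: dhomogM => //; apply: pihomogP.
by rewrite neq_ltn (leq_trans lt_ed) ?orbT // leq_addr.
Qed.

End Homogeneous.

Section ThreeGenerators.

Variables (F : fieldType) (g : 'I_3 -> {mpoly F[3]}).

Definition ideal3 p := exists x : 'I_3 -> {mpoly F[3]}, p = \sum_l x l * g l.

Lemma ideal3_ideal : is_ideal ideal3.
Proof.
split.
- by exists (fun=> 0); rewrite big1 // => l _; rewrite mul0r.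
- move=> _ _ [x ->] [y ->]; exists (fun l => x l + y l).
  by rewrite -big_split; apply: eq_bigr => l _; rewrite mulrDl.
- move=> p _ [x ->]; exists (fun l => p * x l).
  by rewrite mulr_sumr; apply: eq_bigr => l _; rewrite mulrA.
Qed.

Lemma ideal3_gen l : ideal3 (g l).
Proof.
exists (fun m => (m == l)%:R); rewrite (bigD1 l) //= eqxx mul1r big1 ?addr0 // => m /negPf ->.
by rewrite mul0r.
Qed.

End ThreeGenerators.

Definition lin (F : fieldType) (v : 'I_3 -> F) : {mpoly F[3]} := \sum_k v k *: 'X_k.

Lemma lin_homog (F : fieldType) (v : 'I_3 -> F) : lin v \is 1.-homog.
Proof. by apply: rpred_sum => k _; apply: rpredZ; rewrite dhomogX /= mdeg1. Qed.

Lemma lin_eval (F : fieldType) (v c : 'I_3 -> F) : (lin v).@[c] = \sum_k v k * c k.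
Proof. by rewrite raddf_sum; apply: eq_bigr => k _; rewrite /= mevalZ mevalXU. Qed.

Lemma coefM_top (R : nzRingType) (p p' : {poly R}) d e :
  (size p <= d.+1)%N -> (size p' <= e.+1)%N -> (p * p')`_(d + e) = p`_d * p'`_e.
Proof.
move=> s s'; have lt_d : (d < (d + e).+1)%N by rewrite ltnS leq_addr.
rewrite coefM (bigD1 (Ordinal lt_d)) //= addKn big1 ?addr0 // => i ne.
have [lt_id|lt_di|eq_id] := ltngtP i d.
- by rewrite [p'`__]nth_default ?mulr0 // (leq_trans s') //; lia.
- by rewrite nth_default ?mul0r // (leq_trans s).
- by case/eqP: ne; apply: val_inj.
Qed.

Lemma bform_homog (F : fieldType) (v w : 'I_3 -> F) n P :
  bform (lin v) (lin w) n P \is n.-homog.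
Proof.
apply: rpred_sum => i _; apply: rpredZ.
have := dhomogM (dhomogMn i (lin_homog v)) (dhomogMn (n - i) (lin_homog w)).
by rewrite !mul1n subnKC // -ltnS.
Qed.

Section Line.

Variables (F : fieldType) (q a b l1 l2 l3 : 'I_3 -> F).
Local Notation L1 := (lin l1).
Local Notation L2 := (lin l2).
Local Notation L := (lin l3).

Definition dual_frame := forall l, 'X_l = q l *: L1 + a l *: L2 + b l *: L :> {mpoly F[3]}.

(* Restriction to the line L = 0, parametrised with q as the point at infinity. *)
Definition restr (g : {mpoly F[3]}) : {poly F} :=
  mmap (@polyC F) (fun l => q l *: 'X + (a l)%:P) g.

Lemma restr_eval g s : (restr g).[s] = g.@[fun l => q l * s + a l].
Proof.
elim/mpoly_alg_ind: g => [c|i|p p' IH IH'|p p' IH IH'].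
- by rewrite /restr mmapC mevalC hornerC.
- by rewrite /restr mmapX mmap1U mevalXU hornerD hornerZ hornerX hornerC.
- by rewrite /restr mmapD mevalD hornerD -IH -IH'.
- by rewrite /restr rmorphM mevalM hornerM -IH -IH'.
Qed.

Hypothesis frame : dual_frame.

(** The coefficient of index $n$ is the value at the point at infinity $q$; this is how nonvanishing
    at $q$ turns into the leading-coefficient hypotheses on binary forms. *)
Lemma restr_spec n g : g \is n.-homog ->
  [/\ (size (restr g) <= n.+1)%N, (restr g)`_n = g.@[q] &
      exists h, g = bform L1 L2 n (restr g) + L * h].
Proof.
elim/homog_ind: n g / => [d||i|d c p [s cf [h E]]|d p p' [s cf [h E]] [s' cf' [h' E']]
  |d e p p' [s cf [h E]] [s' cf' [h' E']]].
- rewrite /restr mmap0 size_poly0 coef0 meval0; split=> //; exists 0.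
  by rewrite bform0 mulr0 addr0.
- rewrite /restr rmorph1 size_poly1 coef1 meval1; split=> //; exists 0.
  by rewrite bform0E ?size_poly1 // coef1 scale1r mulr0 addr0.
- rewrite /restr mmapX mmap1U mevalXU; split.
  + rewrite (leq_trans (size_polyD _ _)) // geq_max (leq_trans (size_scale_leq _ _)) ?size_polyX //.
    by rewrite size_polyC; case: eqP.
  + by rewrite coefD coefZ coefX coefC mulr1 addr0.
  + by exists (b i)%:MP; rewrite bform1E {1}frame mulrC mul_mpolyC.
- rewrite /restr mmapZ -/(restr p) mul_polyC; split.
  + exact: leq_trans (size_scale_leq _ _) s.
  + by rewrite coefZ mevalZ cf.
  + by exists (c *: h); rewrite bformZ -scalerAr -scalerDr -E.
- rewrite /restr mmapD -/(restr p) -/(restr p'); split.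
  + by rewrite (leq_trans (size_polyD _ _)) // geq_max s.
  + by rewrite coefD mevalD cf cf'.
  + by exists (h + h'); rewrite bformD {1}E {1}E'; ring.
- have -> : restr (p * p') = restr p * restr p' by rewrite /restr rmorphM.
  split.
  + by rewrite (leq_trans (size_polyMleq _ _)) //; move: (size _) (size _) s s' => x y; lia.
  + by rewrite coefM_top // mevalM cf cf'.
  exists (h * p' + bform L1 L2 d (restr p) * h').
  rewrite bformM //; move: E E'; set x := bform _ _ _ _; set y := bform _ _ _ _ => -> ->.
  by ring.
Qed.

Lemma restr_homog n g : g \is n.+1.-homog ->
  exists2 h, h \is n.-homog & g = bform L1 L2 n.+1 (restr g) + L * h.
Proof.
move=> hg; have [s _ [h E]] := restr_spec hg.
exists (pihomog (@mdeg 3) n h); first exact: pihomogP.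
have hb := bform_homog l1 l2 n.+1 (restr g).
rewrite -(pihomogM _ _ (lin_homog l3)) add1n -{1}(pihomog_dE hg) {1}E pihomogD.
by rewrite (pihomog_dE hb).
Qed.

End Line.

(* l1, l2, l3 is the basis of linear forms dual to the basis q, a, b. *)
Definition scalar_frame (F : fieldType) (q a b l1 l2 l3 : 'I_3 -> F) :=
  forall l m, (l == m)%:R = q l * l1 m + a l * l2 m + b l * l3 m.

Lemma dual_frame_scalar (F : fieldType) (q a b l1 l2 l3 : 'I_3 -> F) :
  scalar_frame q a b l1 l2 l3 -> dual_frame q a b l1 l2 l3.
Proof.
move=> frame l; rewrite /lin !scaler_sumr -!big_split /=.
rewrite (bigD1 l) //= big1 ?addr0 => [|m ne]; rewrite !scalerA -!scalerDl -frame ?eqxx ?scale1r //.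
by rewrite eq_sym (negPf ne) scale0r.
Qed.

Lemma homog_msize n (R : nzRingType) (p : {mpoly R[n]}) d : p \is d.-homog -> (msize p <= d.+1)%N.
Proof.
move=> /dhomogP hp; rewrite msizeE big_seq; apply: (big_ind (fun x => (x <= d.+1)%N)) => //.
  by move=> x y; rewrite geq_max => -> ->.
by move=> m /hp /= ->.
Qed.

Lemma msize_subr_pihomog n (R : comNzRingType) (p : {mpoly R[n]}) d :
  (msize p <= d.+1)%N -> (msize (p - pihomog (@mdeg n) d p) <= d)%N.
Proof.
move=> sp; rewrite {1}(pihomog_partitionE sp) big_ord_recr /= addrK.
apply: (big_ind (fun p => (msize p <= d)%N)) => [|x y hx hy|i _].
- by rewrite msize0.
- by rewrite (leq_trans (msizeD_le _ _)) // geq_max hx.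
- by apply: leq_trans (homog_msize (pihomogP _ _ _)) _.
Qed.

(** The ideal need not be homogeneous: reducing a form of degree $d$ may leave a remainder of lower
    degree. *)
Lemma codim_le_degree (F : fieldType) n (I : {mpoly F[n]} -> Prop) (c : nat -> nat) N :
  is_ideal I ->
  (forall d, (N <= d)%N -> c d = 0%N) ->
  (forall d, exists B : 'I_(c d) -> {mpoly F[n]}, forall g, g \is d.-homog ->
     exists e : 'I_(c d) -> F, exists2 h, (msize h <= d)%N & I (g - \sum_i e i *: B i - h)) ->
  codim_le I (\sum_(d < N) c d).
Proof.
move=> idI cN step.
have {}step d : exists B : 'I_(c d) -> {mpoly F[n]}, forall g, (msize g <= d.+1)%N ->
     exists e : 'I_(c d) -> F, exists2 h, (msize h <= d)%N & I (g - \sum_i e i *: B i - h).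
  have [B HB] := step d; exists B => g sg.
  have [e [h sh Ih]] := HB _ (pihomogP (@mdeg n) d g); exists e.
  exists (h + (g - pihomog (@mdeg n) d g)).
    by rewrite (leq_trans (msizeD_le _ _)) // geq_max sh msize_subr_pihomog.
  by move: Ih; set s := \sum_i _; set x := pihomog _ _ _; congr (I _); ring.
(* The filtration must decrease, so layer $j$ holds the polynomials of degree below $N-j$ and the
   sum is read backwards. *)
rewrite (reindex_inj rev_ord_inj) /=.
apply: (codim_le_filtration (K := fun j g => (msize g <= N - j)%N) (c := fun j => c (N - j.+1)%N)) => //.
- move=> g; rewrite subn0; move: {2}(msize g) (leqnn (msize g)) => m; elim: m g => [|m IH] g sg.
    by exists g; rewrite ?subrr ?(leq_trans sg) //; apply: ideal0.
  have [le_Nm|lt_mN] := leqP N m; last first.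
    by exists g; rewrite ?subrr ?(leq_trans sg) //; apply: ideal0.
  have [B HB] := step m; have [e [h sh Ih]] := HB _ sg.
  have [h' sh' Ih'] := IH _ sh; exists h' => //.
  move: Ih; rewrite big1 => [|i _]; last by have := ltn_ord i; rewrite [X in (_ < X)%N]cN.
  rewrite subr0 => Ih; have -> : g - h' = (g - h) + (h - h') by ring.
  exact: idealD.
- by move=> g; rewrite subnn leqn0 msize_poly_eq0 => /eqP ->; apply: ideal0.
move=> j lt_jN; have [B HB] := step (N - j.+1)%N; exists B => g sg; apply: HB.
by rewrite (leq_trans sg) //; lia.
Qed.

(** * Bounding an affine codimension by restriction to the line at infinity *)

Section LineIdeal.

Variables (F : fieldType) (q a b l1 l2 l3 : 'I_3 -> F).
Local Notation L1 := (lin l1).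
Local Notation L2 := (lin l2).
Local Notation L := (lin l3).
Local Notation restr := (restr q a).
Hypothesis frame : dual_frame q a b l1 l2 l3.
Variables (I : {mpoly F[3]} -> Prop) (idI : is_ideal I).
Hypothesis IL : I (L - 1).

(** Modulo $I$ the multiple $Lh$ equals $h$, of lower degree, so the top degree sees only the
    restriction to $L=0$. *)
Lemma restr_reduce n g : g \is n.-homog ->
  exists2 h, (msize h <= n)%N & I (g - bform L1 L2 n (restr g) - h).
Proof.
case: n => [|n] hg; last first.
  have [h hh E] := restr_homog frame hg; exists h; first exact: homog_msize.
  rewrite {1}E; move: (bform _ _ _ _) => x; have -> : x + L * h - x - h = h * (L - 1) by ring.
  exact: idealMl.
have [_ _ [h E]] := restr_spec frame hg; exists 0; first by rewrite msize0.
move: E => /(congr1 (pihomog (@mdeg 3) 0)).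
rewrite pihomogD (pihomogM_lt _ (lin_homog l3)) // !pihomog_dE //; last exact: bform_homog.
by rewrite addr0 => E; rewrite {1}E subrr subr0; apply: ideal0.
Qed.

Lemma bform_reduce n d (f : {mpoly F[3]}) (r : {poly F}) : f \is d.+1.-homog -> I f ->
  (size r <= n.+1 - d.+1)%N ->
  exists2 h, (msize h <= n)%N & I (bform L1 L2 n (r * restr f) - h).
Proof.
move=> hf If sr; have [lt_nd|le_dn] := ltnP n d.+1.
  exists 0; first by rewrite msize0.
  move: sr; have -> : (n.+1 - d.+1 = 0)%N by lia.
  by rewrite leqn0 size_poly_eq0 => /eqP ->; rewrite mul0r bform0 subr0; apply: ideal0.
have [h hh E] := restr_homog frame hf.
have [sf _ _] := restr_spec frame hf.
pose x := bform L1 L2 (n - d.+1) r.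
exists (- (x * h)).
  rewrite msizeN (leq_trans (homog_msize (dhomogM (bform_homog _ _ _ _) hh))) //; lia.
have -> : bform L1 L2 n (r * restr f) = x * bform L1 L2 d.+1 (restr f).
  by rewrite -bformM ?subnK // -subSn.
have -> : bform L1 L2 d.+1 (restr f) = f - L * h by rewrite {2}E addrK.
have -> : x * (f - L * h) - - (x * h) = x * f - x * h * (L - 1) by ring.
by apply: idealB => //; apply: idealMl.
Qed.

(** The degree filtration of $S/I$ has as $n$-th layer a quotient of the binary forms of degree $n$
    by the restrictions of the generators; it suffices to count there. *)
Lemma line_codim (T : finType) (f : T -> {mpoly F[3]}) d (c : nat -> nat) N :
  (forall t, f t \is d.+1.-homog) -> (forall t, I (f t)) ->
  (forall n, (N <= n)%N -> c n = 0%N) ->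
  (forall n, exists B : 'I_(c n) -> {poly F}, forall P : {poly F}, (size P <= n.+1)%N ->
     exists e (r : T -> {poly F}), (forall t, size (r t) <= n.+1 - d.+1)%N /\
       P = \sum_i e i *: B i + \sum_t r t * restr (f t)) ->
  codim_le I (\sum_(n < N) c n).
Proof.
move=> hf If cN HB; apply: codim_le_degree => // n.
have [B {}HB] := HB n; exists (fun i => bform L1 L2 n (B i)) => g hg.
have [h sh Ih] := restr_reduce hg; have [sg _ _] := restr_spec frame hg.
have [e [r [sr E]]] := HB _ sg; exists e.
have /fin_all_exists2 [hs shs Ihs] : forall t, exists2 h, (msize h <= n)%N &
    I (bform L1 L2 n (r t * restr (f t)) - h).
  by move=> t; apply: (bform_reduce (hf t)).
exists (h + \sum_t hs t).
  rewrite (leq_trans (msizeD_le _ _)) // geq_max sh /=.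
  apply: (big_ind (fun p => (msize p <= n)%N)) => [|x y hx hy|t _] //; first by rewrite msize0.
  by rewrite (leq_trans (msizeD_le _ _)) // geq_max hx.
move: Ih; rewrite E bformD !bform_sum; under eq_bigr do rewrite bformZ.
set s := \sum_i _; set x := \sum_t _ => Ih.
have -> : g - s - (h + \sum_t hs t) = (g - (s + x) - h) + (x - \sum_t hs t) by ring.
by apply: idealD => //; rewrite /x -sumrB; apply: ideal_sum.
Qed.

End LineIdeal.

(** * The codimension of an ideal bounds the number of its zeros *)

Section PointCount.

Variable F : fieldType.
Implicit Types c : 3.-tuple F.

Let sep c c' : {mpoly F[3]} :=
  if [pick l | tnth c l != tnth c' l] is Some l then 'X_l - (tnth c' l)%:MP else 1.

Lemma sep_vanish c c' : c != c' -> (sep c c').@[tnth c'] = 0.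
Proof.
move=> ne; rewrite /sep; case: pickP => [l _|eqc].
  by rewrite mevalB mevalXU mevalC subrr.
by case/eqP: ne; apply: eq_from_tnth => l; apply/eqP; rewrite -[_ == _]negbK (eqc l).
Qed.

Lemma sep_neq0 c c' : (sep c c').@[tnth c] != 0.
Proof.
rewrite /sep; case: pickP => [l ne|eqc].
  by rewrite mevalB mevalXU mevalC subr_eq0.
by rewrite meval1 oner_neq0.
Qed.

(** The polynomials [u i] vanish at all listed points except the $i$-th. Evaluating a dependency
    modulo $I$ at the $j$-th point kills its $j$-th coefficient. *)
Lemma codim_le_card_zeros (I : {mpoly F[3]} -> Prop) N (cs : seq (3.-tuple F)) :
  is_ideal I -> codim_le I N -> uniq cs ->
  (forall c, c \in cs -> forall g, I g -> g.@[tnth c] = 0) -> (size cs <= N)%N.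
Proof.
move=> idI IN Ucs Hz; rewrite leqNgt; apply/negP => ltN.
pose pt := tnth (in_tuple cs).
have injpt : injective pt by apply/tuple_uniqP.
pose u i := \prod_(j | j != i) sep (pt i) (pt j).
have [v v0 Iv] := codim_le_dependent u idI IN ltN.
case/eqP: v0; apply/rowP => j; rewrite mxE.
have := Hz _ (mem_tnth j (in_tuple cs)) _ Iv; rewrite -/(pt j) raddf_sum /= (bigD1 j) //=.
rewrite big1 ?addr0 => [|i ne].
  rewrite mevalZ => /eqP; rewrite mulf_eq0 (rmorph_prod (meval (tnth (pt j)))).
  case/orP => [/eqP //|]; case/prodf_eq0 => i _; by rewrite (negPf (sep_neq0 _ _)).
rewrite mevalZ (rmorph_prod (meval (tnth (pt j)))) /= (bigD1 j) /=; last by rewrite eq_sym.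
by rewrite sep_vanish ?mul0r ?mulr0 //; apply: contra ne => /eqP/injpt ->.
Qed.

End PointCount.

(** * Bezout's inequality in the chart $L=1$ *)

Section Bezout.

Variables (F : fieldType) (q a b l1 l2 l3 : 'I_3 -> F).
Hypothesis frame : dual_frame q a b l1 l2 l3.

(** The two curves do not meet on $L=0$, so their restrictions are coprime binary forms of degree
    $d+1$, whose quotient has total dimension $(d+1)^2$. *)
Lemma card_common_zeros d (f1 f2 : {mpoly F[3]}) (cs : seq (3.-tuple F)) :
  f1 \is d.+1.-homog -> f2 \is d.+1.-homog ->
  coprimep (restr q a f1) (restr q a f2) -> f1.@[q] != 0 -> uniq cs ->
  (forall c, c \in cs ->
     [/\ (lin l3).@[tnth c] = 1, f1.@[tnth c] = 0 & f2.@[tnth c] = 0]) ->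
  (size cs <= d.+1 * d.+1)%N.
Proof.
move=> h1 h2 cop f1q Ucs Hz.
pose I g := exists x y z, g = x * f1 + y * f2 + z * (lin l3 - 1).
have idI : is_ideal I.
  split.
  - by exists 0, 0, 0; ring.
  - by move=> _ _ [x [y [z ->]]] [x' [y' [z' ->]]]; exists (x + x'), (y + y'), (z + z'); ring.
  - by move=> t _ [x [y [z ->]]]; exists (t * x), (t * y), (t * z); ring.
apply: (codim_le_card_zeros idI _ Ucs); last first.
  move=> c /Hz [Lc f1c f2c] _ [x [y [z ->]]].
  by rewrite !mevalD !mevalM mevalB meval1 Lc f1c f2c subrr !mulr0 !addr0.
have [s1 c1 _] := restr_spec frame h1; have [s2 _ _] := restr_spec frame h2.
rewrite -(sum_form_codim d.+1 0).
apply: (line_codim (T := bool) (f := fun t => if t then f1 else f2) frame idI _ (d := d)) => //.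
- by exists 0, 0, 1; ring.
- by case.
- by case; [exists 1, 0, 0 | exists 0, 1, 0]; ring.
- by move=> n; rewrite /form_codim; lia.
move=> n; have lead : ((restr q a f1)`_d.+1 != 0) || ((restr q a f2)`_d.+1 != 0) by rewrite c1 f1q.
have [B HB] := coprime_forms_span n s1 s2 cop lead; exists B => P /HB [e [r1 [r2 [sr1 sr2 E]]]].
exists e, (fun t : bool => if t then r1 else r2); split; first by case.
by rewrite big_bool /= addrA.
Qed.

End Bezout.

(** * Three binary forms without common zero generate all forms of large degree *)

Section ThreeForms.

Variables (F : closedFieldType) (G : 'I_3 -> {poly F}) (e : nat) (l0 : 'I_3).
Hypothesis sG : forall l, (size (G l) <= e.+1)%N.
Hypothesis leadG : (G l0)`_e != 0.
Hypothesis nozero : forall s, exists l, (G l).[s] != 0.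

Lemma three_forms_bezout : exists v : 'I_3 -> {poly F}, \sum_l v l * G l = 1.
Proof.
have cop : coprimep (gcdp (G i0) (G i1)) (G i2).
  apply/Pdiv.ClosedField.coprimepP => s; rewrite root_gcd => /andP [/rootP r0 /rootP r1].
  by have [l] := nozero s; elim/ord3P: l; rewrite ?r0 ?r1 ?eqxx.
have [[x y] /= xy] := Bezout_eq1_coprimepP _ _ cop.
have [[x' y'] /= /eqpf_eq [c c0 E]] := Bezoutp (G i0) (G i1).
pose v l := if l == i0 then c^-1 *: (x * x') else if l == i1 then c^-1 *: (x * y') else y.
exists v; rewrite big_ord3 /v /= -xy addrA; congr (_ + _).
rewrite -!scalerAl -scalerDr -!mulrA -mulrDr E -scalerAr scalerA mulVf // scale1r //.
Qed.

(** Coefficients other than that of [G l0] are reduced modulo [G l0]. Their products then have size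
    at most $2e\le n+1$, so the exact quotient by [G l0] has the right size too. *)
Lemma three_forms_span n (P : {poly F}) :
  (e + e <= n.+1)%N -> (size P <= n.+1)%N ->
  exists r : 'I_3 -> {poly F},
    (forall l, (size (r l) <= n.+1 - e)%N) /\ P = \sum_l r l * G l.
Proof.
move=> le_en sP; have [v Ev] := three_forms_bezout.
have szG0 : size (G l0) = e.+1.
  by apply/eqP; rewrite eqn_leq sG ltnNge; apply: contra leadG => /leq_sizeP/(_ e (leqnn e))/eqP.
have G0 : G l0 != 0 by rewrite -size_poly_eq0 szG0.
pose m l : {poly F} := (P * v l) %% G l0.
have sm l : (size (m l) <= e)%N by rewrite -ltnS -szG0 ltn_modp.
pose R := P - \sum_(l | l != l0) m l * G l.
have dvR : G l0 %| R.
  have -> : R = (P * v l0 + \sum_(l | l != l0) (P * v l) %/ G l0 * G l) * G l0.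
    have -> : R = P * (\sum_l v l * G l) - \sum_(l | l != l0) m l * G l by rewrite Ev mulr1.
    rewrite (bigD1 l0) //= mulrDr mulrA -addrA mulrDl; congr (_ + _).
    rewrite mulr_sumr mulr_suml -sumrB; apply: eq_bigr => l _.
    by rewrite mulrA {1}(divp_eq (P * v l) (G l0)) -/(m l); move: (_ %/ _) (m l) => x y; ring.
  exact: dvdp_mulIr.
exists (fun l => if l == l0 then R %/ G l0 else m l); split=> [l|].
  case: eqP => _; last by apply: leq_trans (sm l) _; lia.
  rewrite size_divp // szG0 /= leq_sub2r //.
  rewrite (leq_trans (size_polyD _ _)) // geq_max sP size_polyN /=.
  apply: (big_ind (fun p : {poly F} => (size p <= n.+1)%N)) => [|x y hx hy|l' _].
  - by rewrite size_poly0.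
  - by rewrite (leq_trans (size_polyD _ _)) // geq_max hx.
  rewrite (leq_trans (size_polyMleq _ _)) //.
  by move: (size _) (size _) (sm l') (sG l') => x y; lia.
rewrite (bigD1 l0) //= eqxx divpK //.
rewrite (eq_bigr (fun l => m l * G l)); last by move=> l /negPf ->.
by rewrite subrK.
Qed.

End ThreeForms.

(** * A line avoiding the intersection points *)

Lemma poly_nonroot (F : numDomainType) (p : {poly F}) : p != 0 -> exists x, p.[x] != 0.
Proof.
move=> p0; pose rs : seq F := [seq i%:R | i <- iota 0 (size p)].
have Urs : uniq rs by rewrite map_inj_uniq ?iota_uniq // => i j /eqP; rewrite eqr_nat => /eqP.
case: (boolP (all (root p) rs)) => [/(max_poly_roots p0)/(_ Urs)|].
  by rewrite size_map size_iota ltnn.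
by case/allPn => x _ px; exists x.
Qed.

Lemma digits_inj N x y x' y' : (x < N)%N -> (x' < N)%N ->
  (x + N * y = x' + N * y')%N -> x = x' /\ y = y'.
Proof.
move=> lt lt' E; have N0 : (0 < N)%N by apply: leq_ltn_trans lt.
have ex : x = x'.
  by have := congr1 (modn^~ N) E; rewrite !(mulnC N) !(addnC _ (_ * N)) !modnMDl !modn_small.
split=> //; move/eqP: E; rewrite ex eqn_add2l eqn_pmul2l // => /eqP //.
Qed.

(* Kronecker substitution *)
Lemma mpoly_nonroot (F : numDomainType) (p : {mpoly F[3]}) :
  p != 0 -> exists v : 'I_3 -> F, p.@[v] != 0.
Proof.
move=> p0; pose N := msize p.
pose w (l : 'I_3) : nat := if l == i0 then 1%N else if l == i1 then N else (N * N)%N.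
pose ka (m : 'X_{1..3}) := (m i0 + N * (m i1 + N * m i2))%N.
have kaE (m : 'X_{1..3}) : (\sum_l w l * m l)%N = ka m by rewrite big_ord3 /w /= /ka; lia.
pose P : {poly F} := \sum_(m <- msupp p) p@_m *: 'X^(ka m).
have lt_m m l : m \in msupp p -> (m l < N)%N.
  move=> /msize_mdeg_lt; apply: leq_ltn_trans; rewrite mdegE (bigD1 l) //=; exact: leq_addr.
have inj_ka : {in msupp p &, injective ka}.
  move=> m m' mp m'p /(digits_inj (lt_m _ i0 mp) (lt_m _ i0 m'p)) [e0].
  move=> /(digits_inj (lt_m _ i1 mp) (lt_m _ i1 m'p)) [e1 e2].
  by apply/mnmP; elim/ord3P.
have P0 : P != 0.
  pose m := mlead p; have mp : m \in msupp p by apply: mlead_supp.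
  apply/eqP => /(congr1 (fun P : {poly F} => P`_(ka m))); rewrite coef0 coef_sum (bigD1_seq m) //=.
  rewrite big_seq_cond big1 ?addr0 => [|m' /andP [m'p ne]]; last first.
    rewrite coefZ coefXn; case: eqP => [/esym/(inj_ka _ _ m'p mp) e|_]; last by rewrite mulr0.
    by rewrite e eqxx in ne.
  by rewrite coefZ coefXn eqxx mulr1 => /eqP; rewrite mcoeff_eq0 mp.
have [x Px] := poly_nonroot P0; exists (fun l => x ^+ w l).
suff -> : p.@[fun l => x ^+ w l] = P.[x] by [].
rewrite mevalE /P horner_sum; apply: eq_bigr => m _; rewrite hornerZ hornerXn; congr (_ * _).
by rewrite -kaE -prodrXr; apply: eq_bigr => l _; rewrite exprM.
Qed.

Definition smooth_form (F : fieldType) (f : {mpoly F[3]}) := forall v : 'I_3 -> F,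
  (exists l, v l != 0) -> f.@[v] = 0 -> exists l, (mderiv l f).@[v] != 0.

Definition transversal (F : fieldType) (f g : {mpoly F[3]}) := forall v : 'I_3 -> F,
  (exists l, v l != 0) -> f.@[v] = 0 -> g.@[v] = 0 ->
  ~ exists c, forall l, (mderiv l f).@[v] = c * (mderiv l g).@[v].

(** * Lines through $q$ and common points of two curves on them *)

Section Pencil.

Variables (F : numClosedFieldType) (q a b l1 l2 l3 : 'I_3 -> F).
Hypothesis frame : scalar_frame q a b l1 l2 l3.

Definition pencil_point s t : 'I_3 -> F := fun l => q l * s + (a l + b l * t).

Hypothesis pencil_nz : forall s t, exists l, pencil_point s t l != 0.

Local Notation FF := {poly {poly F}}.

(** The outer variable is $s$, the position on a line through $q$; the inner one is $t$, the
    parameter of the line. *)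
Definition pencil_coord (l : 'I_3) : FF := (q l)%:P *: 'X + ((a l)%:P + b l *: 'X)%:P.

Definition pencil (g : {mpoly F[3]}) : FF := mmap (@polyC _ \o @polyC F) pencil_coord g.

Let ev s t (p : FF) : F := p.[s%:P].[t].

Lemma pencil_eval g s t : ev s t (pencil g) = g.@[pencil_point s t].
Proof.
elim/mpoly_alg_ind: g => [c|i|p p' IH IH'|p p' IH IH'].
- by rewrite /pencil mmapC mevalC /ev !hornerC.
- by rewrite /pencil mmapX mmap1U mevalXU /ev /pencil_coord /pencil_point !hornerE.
- by rewrite /pencil mmapD mevalD /ev !hornerD -IH -IH'.
- by rewrite /pencil rmorphM mevalM /ev !hornerM -IH -IH'.
Qed.

Definition derivation (D : FF -> FF) :=
  [/\ forall x y, D (x + y) = D x + D y,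
      forall x y, D (x * y) = D x * y + x * D y & forall c, D c%:P%:P = 0].

Lemma derivation_pencil D g : derivation D ->
  D (pencil g) = \sum_l pencil (mderiv l g) * D (pencil_coord l).
Proof.
move=> [DD DM DC]; elim/mpoly_alg_ind: g => [c|i|p p' IH IH'|p p' IH IH'].
- rewrite /pencil mmapC /= DC big1 // => l _.
  by rewrite mderivC mmap0 mul0r.
- rewrite /pencil mmapX mmap1U (bigD1 i) //= big1 => [|l ne].
    by rewrite mderivXU eqxx rmorph1 mul1r addr0.
  by rewrite mderivXU eq_sym (negPf ne) mmap0 mul0r.
- have PD x y : pencil (x + y) = pencil x + pencil y by rewrite /pencil mmapD.
  rewrite PD DD IH IH' -big_split; apply: eq_bigr => l _.
  by rewrite mderivD PD mulrDl.
- have PD x y : pencil (x + y) = pencil x + pencil y by rewrite /pencil mmapD.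
  have PM x y : pencil (x * y) = pencil x * pencil y by rewrite /pencil rmorphM.
  rewrite PM DM IH IH' mulr_suml mulr_sumr -big_split; apply: eq_bigr => l _ /=.
  by rewrite mderivM PD !PM; ring.
Qed.

Definition deriv_s (p : FF) : FF := p^`().
Definition deriv_t (p : FF) : FF := swapXY (swapXY p)^`().

Lemma derivation_s : derivation deriv_s.
Proof.
split=> [x y|x y|c]; rewrite /deriv_s ?derivD ?derivM ?derivC //.
Qed.

Lemma derivation_t : derivation deriv_t.
Proof.
split=> [x y|x y|c]; rewrite /deriv_t.
- by rewrite !rmorphD /= derivD rmorphD.
- by rewrite rmorphM /= derivM rmorphD !rmorphM /= !swapXYK.
- by rewrite swapXY_polyC map_polyC /= derivC rmorph0.
Qed.

Lemma deriv_s_coord l : deriv_s (pencil_coord l) = (q l)%:P%:P.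
Proof. by rewrite /deriv_s /pencil_coord derivD derivZ derivX derivC addr0 -mul_polyC mulr1. Qed.

Lemma deriv_t_coord l : deriv_t (pencil_coord l) = (b l)%:P%:P.
Proof.
rewrite /deriv_t /pencil_coord -mul_polyC rmorphD rmorphM /= swapXY_X !swapXY_polyC.
rewrite rmorphD /= !map_polyC /= -mul_polyC rmorphM /= map_polyC map_polyX /=.
by rewrite !(derivD, derivM, derivC, derivX) !(mul0r, mulr0, add0r, addr0, mulr1) swapXY_polyC map_polyC.
Qed.

(** The two parameters see only the derivatives along $q$ and $b$. Since $v=sq+a+tb$ lies on the
    curve, Euler's formula supplies the derivative along $a$. *)
Lemma pencil_gradient g s t d : g \is d.-homog -> ev s t (pencil g) = 0 ->
  forall m, (mderiv m g).@[pencil_point s t] =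
    (l1 m - s * l2 m) * ev s t (deriv_s (pencil g)) +
    (l3 m - t * l2 m) * ev s t (deriv_t (pencil g)).
Proof.
move=> hg; rewrite pencil_eval => gv m; set v := pencil_point s t in gv *.
pose D l := (mderiv l g).@[v].
have evD E cc : derivation E -> (forall l, E (pencil_coord l) = (cc l)%:P%:P) ->
    ev s t (E (pencil g)) = \sum_l D l * cc l.
  move=> dE Ec; rewrite derivation_pencil // /ev !horner_sum; apply: eq_bigr => l _.
  by rewrite Ec !hornerM !hornerC; congr (_ * _); apply: pencil_eval.
rewrite (evD _ _ derivation_s deriv_s_coord) (evD _ _ derivation_t deriv_t_coord).
have Eu : \sum_l D l * a l = - (s * \sum_l D l * q l) - t * \sum_l D l * b l.
  have := euler_eval v hg; rewrite gv mul0rn => Eu.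
  have E : 0 = s * (\sum_l D l * q l) + ((\sum_l D l * a l) + t * \sum_l D l * b l).
    rewrite -[LHS]Eu !mulr_sumr -!big_split /=.
    by apply: eq_bigr => l _; rewrite /v /pencil_point /D; ring.
  by apply/eqP; rewrite -subr_eq0; apply/eqP; rewrite [RHS]E; ring.
have -> : (mderiv m g).@[v] = \sum_l D l * (l == m)%:R.
  by rewrite (bigD1 m) //= eqxx mulr1 big1 ?addr0 // => l /negPf ->; rewrite mulr0.
have -> : \sum_l D l * (l == m)%:R =
   l1 m * (\sum_l D l * q l) + l2 m * (\sum_l D l * a l) + l3 m * (\sum_l D l * b l).
  rewrite !mulr_sumr -!big_split /=; apply: eq_bigr => l _; rewrite frame; ring.
rewrite Eu; ring.
Qed.

Lemma evD s t x y : ev s t (x + y) = ev s t x + ev s t y.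
Proof. by rewrite /ev !hornerD. Qed.

Lemma evM s t x y : ev s t (x * y) = ev s t x * ev s t y.
Proof. by rewrite /ev !hornerM. Qed.

Lemma pencil_neq0 f d : f \is d.-homog -> f.@[q] != 0 -> pencil f != 0.
Proof.
move=> hf fq; apply/eqP => p0.
have [_ co _] := restr_spec (dual_frame_scalar frame) hf.
have : restr q a f = 0.
  apply/eqP; apply: contraTT isT => /poly_nonroot [s]; rewrite restr_eval.
  have := pencil_eval f s 0; rewrite p0 /ev !horner0 => E; rewrite (meval_eq (v2 := pencil_point s 0)).
    by rewrite -E eqxx.
  by move=> l; rewrite /pencil_point mulr0 addr0.
by move=> r0; move: co; rewrite r0 coef0 => /esym/eqP; rewrite (negPf fq).
Qed.

(* Otherwise the two curves have a common component h, and at a zero of h both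
   gradients are multiples of the gradient of h. *)
Lemma pencil_generic f g d : f \is d.-homog -> g \is d.-homog ->
  f.@[q] != 0 ->
  smooth_form g ->
  transversal f g ->
  exists2 c : {poly F}, c != 0 & forall t, c.[t] != 0 ->
    forall s, f.@[pencil_point s t] = 0 -> g.@[pencil_point s t] = 0 -> False.
Proof.
move=> hf hg fq smooth trans.
have [/Bezout_coprimepP [[x y] /= /eqpP [[c1 c2] /= /andP [c10 c20] E]]|] :=
  boolP (coprimep (pencil f) (pencil g)).
  (* Over $F[t]$ the Bezout relation holds up to a nonzero $c_2(t)$; at a common zero on the line
     $t$ it reads $c_2(t)=0$. *)
  exists c2 => // t ct s fv gv.
  have := congr1 (ev s t) E; rewrite -!mul_polyC !evM evD !evM !pencil_eval fv gv.
  rewrite !mulr0 addr0 mulr0 /ev !hornerC mulr1 => /esym/eqP; rewrite (negPf ct) //.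
rewrite coprimep_def => szh; set h := gcdp _ _ in szh.
have f0 := pencil_neq0 hf fq.
have h0 : h != 0 by rewrite gcdp_eq0 (negPf f0).
have {}szh : (1 < size h)%N by rewrite ltn_neqAle eq_sym szh lt0n size_poly_eq0.
have /Pdiv.Idomain.dvdpP [[c x] /= c0 Ef] := dvdp_gcdl (pencil f) (pencil g).
have /Pdiv.Idomain.dvdpP [[c' x'] /= c0' Eg] := dvdp_gcdr (pencil f) (pencil g).
(* This $t$ avoids the denominators of both divisions and preserves the degree of $h$ in $s$, so
   that $h$ has a zero on the line. *)
have [t] : exists t, (c * c' * lead_coef h).[t] != 0.
  by apply: poly_nonroot; rewrite !mulf_neq0 // lead_coef_eq0.
rewrite !hornerM !mulf_eq0 !negb_or => /andP [/andP [ct ct'] ht].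
have [s hs] : exists s, ev s t h = 0.
  pose ht' := map_poly (horner_eval t) h.
  have sht : size ht' = size h by apply: size_map_poly_id0; rewrite horner_evalE.
  have /closed_rootP [s /rootP rs] : size ht' != 1%N by rewrite sht gtn_eqF.
  exists s; rewrite -{}rs /ev -[RHS]/(ht'.[s]) /ht'.
  have -> : s = horner_eval t s%:P by rewrite horner_evalE hornerC.
  by rewrite horner_map horner_evalE /= horner_evalE hornerC.
rewrite -/h in Ef Eg.
have key p cc xx : cc.[t] != 0 -> cc *: p = xx * h ->
    ev s t p = 0 /\ forall D, derivation D -> ev s t (D p) = (ev s t xx / cc.[t]) * ev s t (D h).
  move=> cct E.
  have pz : ev s t p = 0.
    apply: (mulfI cct); have := congr1 (ev s t) E; rewrite -mul_polyC !evM hs mulr0 /ev hornerC => ->.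
    by rewrite mulr0.
  split=> // D [_ DM _].
  have := congr1 (fun z => ev s t (D z)) E; rewrite -mul_polyC !DM !evD !evM hs pz !mulr0 !add0r.
  rewrite {1}/ev hornerC => E2; apply: (mulfI cct); rewrite E2.
  by rewrite mulrA [cc.[t] * _]mulrC divfK.
have [fz Df] := key _ _ _ ct Ef; have [gz Dg] := key _ _ _ ct' Eg.
have gf := pencil_gradient hf fz; have gg := pencil_gradient hg gz.
rewrite !pencil_eval in fz gz.
rewrite !(Dg _ derivation_s, Dg _ derivation_t) in gg.
rewrite !(Df _ derivation_s, Df _ derivation_t) in gf.
set v := pencil_point s t in gf gg fz gz.
have vnz : exists l, v l != 0 := pencil_nz s t.
set ds := ev s t (deriv_s h) in gf gg; set dt := ev s t (deriv_t h) in gf gg.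
exfalso.
(* If the cofactor of $g$ vanishes, so does the gradient of $g$, against smoothness; otherwise the
   gradient of $f$ is a multiple of that of $g$, against transversality. *)
have [xz|xnz] := eqVneq (ev s t x') 0.
  have [l] := smooth v vnz gz; rewrite gg xz; case/eqP; ring.
apply: (trans v vnz fz gz).
exists ((ev s t x / c.[t]) / (ev s t x' / c'.[t])) => l; rewrite gf gg; field.
by rewrite xnz ct ct'.
Qed.

End Pencil.

Lemma prod_homog n (R : comNzRingType) k d (f : 'I_k -> {mpoly R[n]}) :
  (forall i, f i \is d.-homog) -> \prod_i f i \is (k * d).-homog.
Proof.
elim: k f => [|k IH] f hf; first by rewrite big_ord0 dhomog1.
by rewrite big_ord_recl mulSn; apply: dhomogM => //; apply: IH.
Qed.

Lemma lin_neq0 (F : fieldType) (v : 'I_3 -> F) m : v m != 0 -> lin v != 0.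
Proof.
apply: contraNneq => /(congr1 (meval (fun l => (l == m)%:R))).
rewrite lin_eval meval0 (bigD1 m) //= eqxx mulr1 big1 ?addr0 // => [->|l /negPf ->] //.
by rewrite mulr0.
Qed.

Lemma nil_at_point (F : fieldType) (Q : {mpoly F[3]} -> Prop) (c : 'I_3 -> F) m g :
  is_ideal Q -> (forall l, Q (('X_l - (c l)%:MP) ^+ m)) ->
  exists M, Q ((g - (g.@[c])%:MP) ^+ M).
Proof.
move=> idQ Qx; elim/mpoly_alg_ind: g => [x|i|p p' [M H] [M' H']|p p' [M H] [M' H']].
- by exists 1%N; rewrite mevalC subrr expr1; apply: ideal0.
- by exists m; rewrite mevalXU.
- exists (M + M')%N; rewrite mevalD mpolyCD.
  by rewrite opprD addrACA; apply: ideal_nilD.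
- exists (M + M')%N; rewrite mevalM mpolyCM.
  have -> : p * p' - p.@[c]%:MP * p'.@[c]%:MP =
     p' * (p - p.@[c]%:MP) + p.@[c]%:MP * (p' - p'.@[c]%:MP) by ring.
  by apply: ideal_nilD => //; apply: ideal_nilMl.
Qed.

(** Near $c$ the polynomial $g$ is a unit, being $g(c)$ plus a nilpotent, so the local part is
    zero. *)
Lemma codim_le0_at_point (F : fieldType) (Q : {mpoly F[3]} -> Prop) (c : 'I_3 -> F) m g :
  is_ideal Q -> (forall l, Q (('X_l - (c l)%:MP) ^+ m)) -> Q g -> g.@[c] != 0 -> codim_le Q 0.
Proof.
move=> idQ Qx Qg gc; apply: codim_le0 => //.
have [M H] := nil_at_point g idQ Qx.
apply: (ideal_unit_nil idQ gc Qg (h := g.@[c]%:MP - g) (m := M)).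
  by rewrite alg_mpolyC opprB addrC subrK.
by rewrite -opprB -mulN1r exprMn; apply: idealMl.
Qed.

Lemma card_pairs (T : finType) (Z : {set T}) :
  (\sum_(ij : T * T | ij.1 != ij.2) ((ij.1 \in Z) && (ij.2 \in Z)) = #|Z| * #|Z|.-1)%N.
Proof.
rewrite -(pair_big_dep xpredT (fun i j => i != j) (fun i j => ((i \in Z) && (j \in Z) : nat))) /=.
rewrite (bigID (mem Z)) /= [X in (_ + X)%N]big1 ?addn0 => [|i /negPf iZ]; last first.
  by rewrite big1 // => j _; rewrite iZ.
rewrite (eq_bigr (fun=> #|Z|.-1)) ?sum_nat_const // => i iZ.
have -> : #|Z|.-1 = #|Z :\ i| by rewrite (cardsD1 i Z) iZ.
rewrite  -sum1_card big_mkcond [RHS]big_mkcond /=.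
by apply: eq_bigr => j _; rewrite iZ !inE eq_sym; case: (j == i); case: (j \in Z).
Qed.

(** * The arrangement and its affine Jacobian algebra *)

Section Arrangement.

Variables (F : numClosedFieldType) (k d : nat) (fs : 'I_k -> {mpoly F[3]}).
Hypothesis hfs : forall i, fs i \is d.-homog.
Hypothesis smooth : forall i, smooth_form (fs i).
Hypothesis transv : forall i j, i != j -> transversal (fs i) (fs j).

Lemma exists_good_frame : exists q a b l1 l2 l3 : 'I_3 -> F,
  [/\ scalar_frame q a b l1 l2 l3, lin l3 != 0,
      (forall s, exists l, q l * s + a l != 0), (forall i, (fs i).@[q] != 0) &
      forall i j, i != j -> coprimep (restr q a (fs i)) (restr q a (fs j))].
Proof.
case: (boolP [forall i, fs i != 0]) => [/forallP fs0|]; last first.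
  rewrite negb_forall => /existsP [ i ]; rewrite negbK => /eqP fi0.
  have nz : exists l, (fun _ : 'I_3 => 1 : F) l != 0 by exists i0; rewrite oner_neq0.
  have := smooth (i := i) nz; rewrite fi0 meval0 => /(_ erefl) [l].
  by rewrite mderiv0 meval0 eqxx.
(* The factor ['X_i0] makes $q_0\ne0$, so that $q$ and two coordinate vectors form a basis. *)
have p0 : 'X_i0 * \prod_i fs i != 0 :> {mpoly F[3]}.
  rewrite mulf_neq0 //; last exact/prodf_neq0.
  by rewrite -msize_poly_eq0 msizeX mdeg1.
have [q] := mpoly_nonroot p0.
rewrite mevalM mevalXU (rmorph_prod (meval q)) mulf_eq0 negb_or => /andP [q0 /prodf_neq0 fq].
pose a0 (l : 'I_3) : F := (l == i1)%:R; pose b (l : 'I_3) : F := (l == i2)%:R.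
pose l1 (l : 'I_3) : F := (l == i0)%:R / q i0.
pose l2 (l : 'I_3) : F := (l == i1)%:R - (l == i0)%:R * (q i1 / q i0).
pose l3 (l : 'I_3) : F := (l == i2)%:R - (l == i0)%:R * (q i2 / q i0).
have fr0 : forall l m, (l == m)%:R = q l * l1 m + a0 l * l2 m + b l * l3 m.
  by elim/ord3P; elim/ord3P; rewrite /l1 /l2 /l3 /a0 /b /=; field.
have nz0 s t : exists l, pencil_point q a0 b s t l != 0.
  have [->|s0] := eqVneq s 0.
    by exists i1; rewrite /pencil_point /a0 /b /= mulr0 mul0r addr0 add0r oner_neq0.
  by exists i0; rewrite /pencil_point /a0 /b /= mul0r !addr0 mulf_neq0.
have /fin_all_exists2 [c c0 Hc] : forall ij : 'I_k * 'I_k, exists2 c : {poly F}, c != 0 &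
    ij.1 != ij.2 -> forall t, c.[t] != 0 -> forall s,
    (fs ij.1).@[pencil_point q a0 b s t] = 0 -> (fs ij.2).@[pencil_point q a0 b s t] = 0 -> False.
  move=> [i j] /=; have [_|ne] := eqVneq i j; first by exists 1; rewrite ?oner_neq0.
  have [c c0 H] := pencil_generic fr0 nz0 (hfs i) (hfs j) (fq i isT) (@smooth j) (transv ne).
  by exists c.
have [t] : exists t, (\prod_ij c ij).[t] != 0 by apply: poly_nonroot; apply/prodf_neq0.
rewrite horner_prod => /prodf_neq0 ct.
(* Replacing $a$ by $a+tb$ changes the dual basis only in its third form. *)
exists q, (fun l => a0 l + b l * t), b, l1, l2, (fun m => l3 m - t * l2 m); split.
- by move=> l m; rewrite fr0; ring.
- by apply: (lin_neq0 (m := i2)); rewrite /l3 /l2 /= !mul0r !subr0 mulr0 subr0 oner_neq0.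
- by move=> s; apply: nz0.
- by move=> i; apply: fq.
move=> i j ne; apply/Pdiv.ClosedField.coprimepP => s; rewrite rootE !restr_eval => /eqP fi.
by apply/eqP => fj; apply: (Hc (i, j) ne t (ct _ isT) s fi fj).
Qed.

Variables q a b l1 l2 l3 : 'I_3 -> F.
Hypothesis frame : scalar_frame q a b l1 l2 l3.
Hypothesis line_nz : forall s, exists l, q l * s + a l != 0.
Hypothesis fq : forall i, (fs i).@[q] != 0.
Hypothesis cop : forall i j, i != j -> coprimep (restr q a (fs i)) (restr q a (fs j)).
Variable e : nat.
Hypothesis kd : (k * d = e.+2)%N.

Let f := \prod_i fs i.
Let L := lin l3.

Lemma f_homog : f \is e.+2.-homog. Proof. by rewrite -kd; apply: prod_homog. Qed.

Lemma df_homog l : mderiv l f \is e.+1.-homog.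
Proof. exact: mderiv_homog f_homog. Qed.

Lemma nonsingular_off_curve v : f.@[v] != 0 -> exists l, (mderiv l f).@[v] != 0.
Proof.
move=> fv; apply/existsP; apply: contraR fv; rewrite negb_exists => /forallP H.
have := euler_eval v f_homog; rewrite big1 => [/esym/eqP|l _].
  by rewrite mulrn_eq0.
by have := H l; rewrite negbK => /eqP ->; rewrite mulr0.
Qed.

(** At most one curve passes through a point of the line. There the derivatives of $f$ are those of
    that curve times the nonzero values of the others. *)
Lemma nonsingular_on_line s : exists l, (mderiv l f).@[fun l => q l * s + a l] != 0.
Proof.
set v := (fun l => q l * s + a l); have [fv|] := eqVneq (f.@[v]) 0; last exact: nonsingular_off_curve.
move/eqP: (fv); rewrite /f (rmorph_prod (meval v)) => /prodf_eq0 [i _ /eqP fiv].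
have [l dl] := smooth (line_nz s) fiv; exists l.
rewrite mderiv_prod raddf_sum /= (bigD1 i) //= [X in _ + X]big1 ?addr0 => [|j ne].
  rewrite mevalM mulf_neq0 // (rmorph_prod (meval v)); apply/prodf_neq0 => j ne.
  have ij : i != j by rewrite eq_sym.
  have /Pdiv.ClosedField.coprimepP/(_ s) := cop ij.
  by rewrite rootE !restr_eval -/v fiv eqxx => /(_ isT).
rewrite mevalM (rmorph_prod (meval v)) /= (bigD1 i) /= ?fiv ?mul0r ?mulr0 //.
by rewrite eq_sym.
Qed.

Lemma restr_df_span n (P : {poly F}) : (e.+1 + e.+1 <= n.+1)%N -> (size P <= n.+1)%N ->
  exists r : 'I_3 -> {poly F}, (forall l, (size (r l) <= n.+1 - e.+1)%N) /\
    P = \sum_l r l * restr q a (mderiv l f).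
Proof.
have fq' : f.@[q] != 0 by rewrite /f (rmorph_prod (meval q)); apply/prodf_neq0 => i _; apply: fq.
have [l0 dl0] := nonsingular_off_curve fq'.
have sp l := restr_spec (dual_frame_scalar frame) (df_homog l).
apply: (three_forms_span (l0 := l0)) => [l||s].
- by case: (sp l).
- by case: (sp l0) => _ -> _.
by have [l] := nonsingular_on_line s; exists l; rewrite restr_eval.
Qed.

Local Notation jacobian_ideal := (ideal3 (fun l => mderiv l f)).
Definition affine_ideal := adjoin jacobian_ideal (L - 1).

Lemma affine_is_ideal : is_ideal affine_ideal.
Proof. exact: (adjoin_ideal (ideal3_ideal _)). Qed.

(** A crude bound, counting all $n+1$ monomials in each small degree: finiteness is what allows the
    decomposition into points. *)
Lemma affine_codim_finite : exists N, codim_le affine_ideal N.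
Proof.
pose N := (e.+1 + e.+1)%N; pose c n := if (n < N)%N then n.+1 else 0%N.
exists (\sum_(n < N) c n)%N.
apply: (line_codim (f := fun l => mderiv l f) (dual_frame_scalar frame) affine_is_ideal _ (d := e)).
- exact: (adjoin_gen (ideal3_ideal _)).
- exact: df_homog.
- by move=> l; apply: adjoin_sub; apply: (ideal3_gen (fun l => mderiv l f)).
- by move=> n; rewrite /c ltnNge => ->.
move=> n; rewrite /c; case: (ltnP n N) => [lt_nN|le_Nn].
  exists (fun i => 'X^i) => P sP; exists (fun i : 'I_n.+1 => P`_i), (fun=> 0); split=> [l|].
    by rewrite size_poly0.
  by rewrite [X in _ + X]big1 => [|l _]; rewrite ?mul0r // addr0 -poly_sum_Xn.
exists (fun=> 0) => P sP; have [r [sr E]] := restr_df_span (leqW le_Nn) sP.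
by exists (fun=> 0), r; split=> //; rewrite big_ord0 add0r.
Qed.

(** Modulo $L$, $p$ is a combination of the restricted derivatives. Replacing these by the
    derivatives themselves costs only another multiple of $L$. *)
Lemma mulL_surjective n p : (e.+1 + e.+1 <= n.+2)%N -> p \is n.+1.-homog ->
  exists2 h, h \is n.-homog & jacobian_ideal (p - L * h).
Proof.
move=> le_n hp; have [h0 hh0 Ep] := restr_homog (dual_frame_scalar frame) hp.
have [sp _ _] := restr_spec (dual_frame_scalar frame) hp.
have [r [sr Er]] := restr_df_span le_n sp.
have /fin_all_exists2 [h hh Eh] : forall l, exists2 h, h \is e.-homog &
    mderiv l f = bform (lin l1) (lin l2) e.+1 (restr q a (mderiv l f)) + L * h.
  by move=> l; apply: (restr_homog (dual_frame_scalar frame)); apply: df_homog.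
have le_en : (e.+1 <= n.+1)%N by lia.
pose x l := bform (lin l1) (lin l2) (n.+1 - e.+1) (r l).
exists (h0 - \sum_l x l * h l).
  apply: rpredB => //; apply: rpred_sum => l _.
  have -> : n = (n.+1 - e.+1 + e)%N by lia.
  by apply: dhomogM => //; apply: bform_homog.
exists x; rewrite {1}Ep {1}Er bform_sum.
have -> : \sum_l bform (lin l1) (lin l2) n.+1 (r l * restr q a (mderiv l f)) =
    \sum_l x l * (mderiv l f - L * h l).
  apply: eq_bigr => l _; have [sf _ _] := restr_spec (dual_frame_scalar frame) (df_homog l).
  rewrite {2}Eh addrK -bformM ?subnK //.
  by rewrite -subSn.
rewrite -/L; set A := \sum_l x l * (_ - _); set s := \sum_l x l * h l.
have -> : A + L * h0 - L * (h0 - s) = A + L * s by ring.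
by rewrite /A /s mulr_sumr -big_split; apply: eq_bigr => l _ /=; ring.
Qed.

Definition curves_at (c : 'I_3 -> F) := [set i | (fs i).@[c] == 0].

Lemma local_codim_at (c : 'I_3 -> F) m : L.@[c] = 1 ->
  codim_le (adjoin_powers affine_ideal c m) (#|curves_at c|.-1 * #|curves_at c|.-1).
Proof.
move=> Lc; set Q := adjoin_powers _ _ _.
have idQ : is_ideal Q := adjoin_powers_ideal c m affine_is_ideal.
have subQ g : affine_ideal g -> Q g := adjoin_powers_sub c m affine_is_ideal.
have Qx l : Q (('X_l - (c l)%:MP) ^+ m) := adjoin_powers_gen c m l affine_is_ideal.
have Qd l : Q (mderiv l f) by apply: subQ; apply: adjoin_sub; apply: (ideal3_gen (fun l => mderiv l f)).
have QL : Q (L - 1) by apply: subQ; apply: (adjoin_gen (ideal3_ideal _)).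
have [Z0|Z0] := eqVneq (curves_at c) set0.
  rewrite Z0 cards0 /=.
  have fc : f.@[c] != 0.
    rewrite /f (rmorph_prod (meval c)); apply/prodf_neq0 => i _.
    by have := in_set0 i; rewrite -Z0 inE => ->.
  have [l dl] := nonsingular_off_curve fc; exact: (codim_le0_at_point idQ Qx (Qd l) dl).
pose x1 := (lin l1).@[c]; pose x2 := (lin l2).@[c].
have cE l : c l = q l * x1 + a l * x2 + b l.
  have := congr1 (meval c) (dual_frame_scalar frame l).
  by rewrite !mevalD !mevalZ mevalXU -/L Lc mulr1.
(* Local coordinates on the plane $L=1$ at $c$; the third frame coordinate is constant modulo
   $L-1$. *)
pose u := lin l1 - x1%:MP; pose w := lin l2 - x2%:MP.
have coordQ l : Q ('X_l - (c l)%:MP - (q l *: u + a l *: w)).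
  have -> : 'X_l - (c l)%:MP - (q l *: u + a l *: w) = (b l)%:MP * (L - 1).
    rewrite (dual_frame_scalar frame l) cE !mpolyCD !mpolyCM /u /w -/L -!mul_mpolyC; ring.
  exact: idealMl.
have [M1 Qu] := nil_at_point (lin l1) idQ Qx; have [M2 Qw] := nil_at_point (lin l2) idQ Qx.
have {}Qu : Q (u ^+ (M2 + M1)) by rewrite exprD; apply: idealMl.
have {}Qw : Q (w ^+ (M2 + M1)) by rewrite exprD; apply: idealMr.
have cnz : exists l, c l != 0.
  apply/existsP; apply: contraPT Lc; rewrite negb_exists => /forallP H.
  rewrite lin_eval big1 => [|l _]; first by move/esym/eqP; rewrite oner_eq0.
  by have := H l; rewrite negbK => /eqP ->; rewrite mulr0.
pose A i := dird c q (fs i); pose B i := dird c a (fs i).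
(* By Euler's formula the gradient depends linearly on the pair $(A_i,B_i)$ alone, so smoothness and
   transversality become conditions on these pairs. *)
have grad i l : i \in curves_at c ->
    (mderiv l (fs i)).@[c] = A i * (l1 l - x1 * l3 l) + B i * (l2 l - x2 * l3 l).
  rewrite inE => /eqP fic; pose D m := (mderiv m (fs i)).@[c].
  have Eb : \sum_m b m * D m = - (x1 * A i) - x2 * B i.
    have := euler_eval c (hfs i); rewrite fic mul0rn => Eu.
    have E : 0 = x1 * A i + (x2 * B i + \sum_m b m * D m).
      rewrite -[LHS]Eu /A /B /dird !mulr_sumr -!big_split /=.
      by apply: eq_bigr => m' _; rewrite {1}cE /D; ring.
    by apply/eqP; rewrite -subr_eq0; apply/eqP; rewrite [RHS]E; ring.
  have -> : (mderiv l (fs i)).@[c] = \sum_m D m * (m == l)%:R.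
    by rewrite (bigD1 l) //= eqxx mulr1 big1 ?addr0 // => m' /negPf ->; rewrite mulr0.
  have -> : \sum_m D m * (m == l)%:R = l1 l * A i + l2 l * B i + l3 l * \sum_m b m * D m.
    rewrite /A /B /dird !mulr_sumr -!big_split /=; apply: eq_bigr => m' _.
    by rewrite frame /D; ring.
  by rewrite Eb; ring.
have nzAB i : i \in curves_at c -> (A i != 0) || (B i != 0).
  move=> iZ; rewrite -negb_and; apply/negP => /andP [/eqP A0 /eqP B0].
  have fic : (fs i).@[c] = 0 by apply/eqP; move: iZ; rewrite inE.
  by have [l] := smooth cnz fic; rewrite grad // A0 B0 !mul0r addr0 eqxx.
apply: (local_codim_curves idQ coordQ Qu Qw Z0 nzAB _ Qd) => i j iZ jZ ne.
rewrite -/(A i) -/(A j) -/(B i) -/(B j); apply/eqP => E.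
have fic : (fs i).@[c] = 0 by apply/eqP; move: iZ; rewrite inE.
have fjc : (fs j).@[c] = 0 by apply/eqP; move: jZ; rewrite inE.
apply: (transv ne cnz fic fjc).
case/orP: (nzAB j jZ) => nz.
- exists (A i / A j) => l; rewrite !grad //.
  have -> : B i = A i * B j / A j by rewrite E mulrC mulrA mulVf // mul1r.
  by field.
- exists (B i / B j) => l; rewrite !grad //.
  have -> : A i = A j * B i / B j by rewrite -E mulfK.
  by field.
Qed.

(** Grid points off the plane $L=1$ contribute nothing, because $L-1$ is a unit there. *)
Lemma affine_codim_points : exists2 cs : seq (3.-tuple F), uniq cs &
  codim_le affine_ideal (\sum_(c <- cs | L.@[tnth c] == 1)
    #|curves_at (tnth c)|.-1 * #|curves_at (tnth c)|.-1).
Proof.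
have [N IN] := affine_codim_finite.
have [cs [m [Ucs H]]] := codim_le_points affine_is_ideal IN.
exists cs => //; rewrite big_mkcond /=; apply: H => c _.
case: eqP => [Lc|/eqP Lc]; first exact: local_codim_at.
have idI := affine_is_ideal.
apply: (codim_le0_at_point (g := L - 1) (c := tnth c) (m := m)).
- exact: adjoin_powers_ideal.
- by move=> l; apply: adjoin_powers_gen.
- by apply: adjoin_powers_sub => //; apply: (adjoin_gen (ideal3_ideal _)).
- by rewrite mevalB meval1 subr_eq0.
Qed.

Hypothesis mult4 : forall v : 'I_3 -> F, (exists l, v l != 0) -> (#|curves_at v| < 5)%N.

Lemma affine_codim_le : exists2 M, codim_le affine_ideal M &
  (4 * M <= 3 * (k * k.-1 * (d * d)))%N.
Proof.
have [cs Ucs HM] := affine_codim_points; eexists; first exact: HM.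
pose good c := L.@[tnth c] == 1.
pose Z (c : 3.-tuple F) := curves_at (tnth c).
apply: (@leq_trans (3 * \sum_(c <- cs | good c) #|Z c| * #|Z c|.-1)%N).
  rewrite !big_distrr /=; apply: leq_sum => c /eqP Lc.
  have : (#|Z c| < 5)%N.
    apply: mult4; apply/existsP; apply: contraPT Lc; rewrite negb_exists => /forallP H.
    rewrite lin_eval big1 => [|l _]; first by move/esym/eqP; rewrite oner_eq0.
    by have := H l; rewrite negbK => /eqP ->; rewrite mulr0.
  (* The inequality $4(m-1)^2\le3m(m-1)$ is an equality at $m=4$, the largest multiplicity
     allowed. *)
  by rewrite -/(Z c); case: #|Z c| => [|[|[|[|[|]]]]].
rewrite leq_mul2l /=.
under eq_bigr do rewrite -card_pairs.
rewrite exchange_big /=.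
have cardp : (\sum_(ij : 'I_k * 'I_k | ij.1 != ij.2) 1 = k * k.-1)%N.
  have := card_pairs [set: 'I_k]; rewrite cardsT card_ord => <-.
  by apply: eq_bigr => ij _; rewrite !inE.
rewrite -cardp big_distrl /=; apply: leq_sum => -[i j] /= ne; rewrite mul1n.
have dgt0 : (0 < d)%N by case: d kd => //; rewrite muln0.
(* After exchanging the sums, each ordered pair of curves counts its common points, to which Bezout
   applies. *)
pose cs' := [seq c <- cs | [&& good c, i \in Z c & j \in Z c]].
have -> : (\sum_(c <- cs | good c) ((i \in Z c) && (j \in Z c)) = size cs')%N.
  rewrite size_filter -sum1_count [RHS]big_mkcond [LHS]big_mkcond /=; apply: eq_bigr => c _.
  by case: (good c) (i \in Z c) (j \in Z c) => [] [] [].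
have hi : fs i \is d.-1.+1.-homog by rewrite prednK.
have hj : fs j \is d.-1.+1.-homog by rewrite prednK.
rewrite -(prednK dgt0).
apply: (card_common_zeros (dual_frame_scalar frame) hi hj (cop ne) (fq i)); first exact: filter_uniq.
move=> c; rewrite mem_filter => /andP [/and3P [/eqP gc]]; rewrite !inE => /eqP -> /eqP -> _.
by split.
Qed.

End Arrangement.

(** * The Hilbert function of a free curve *)

Section GradedPieces.

Variable F : fieldType.
Local Notation S := {mpoly F[3]}.
Local Notation V n := (dhomog 3 F n).
Local Notation pih := (pihomog (@mdeg 3)).

Definition hproj n (p : S) : V n := DHomog (pihomogP (@mdeg 3) n p).

Lemma hproj_linear n : linear (hproj n).
Proof. by move=> c p q; apply: val_inj; rewrite /= linearP. Qed.

HB.instance Definition _ n := GRing.isLinear.Build F S (V n) _ (hproj n) (hproj_linear n).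

Lemma hprojE n p : p \is n.-homog -> hproj n p = p :> S.
Proof. by move=> hp; rewrite /= pihomog_dE. Qed.

Lemma dim_homog n : \dim {: V n} = 'C(n + 2, n).
Proof. by rewrite dimvf. Qed.

Lemma dim_homog2 n : (2 * \dim {: V n} = (n + 2) * (n + 1))%N.
Proof.
rewrite dim_homog -[X in 'C(_, X)](addnK 2 n) bin_sub ?leq_addl // mulnC.
have -> : ('C(n + 2, 2) * 2 = 'C(n + 2, 2) * 2`!)%N by [].
by rewrite bin_ffact ffactnS ffactn1 addn2 addn1.
Qed.

Variables (E : nat) (g : 'I_3 -> S) (hg : forall l, g l \is E.-homog).

Lemma ideal3_pihomog n p : ideal3 g p -> ideal3 g (pih n p).
Proof.
move=> [x ->]; have [le_En|lt_nE] := leqP E n.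
  exists (fun l => pih (n - E) (x l)); rewrite raddf_sum; apply: eq_bigr => l _ /=.
  by rewrite mulrC -{1}(subnKC le_En) pihomogM // mulrC.
exists (fun=> 0); rewrite raddf_sum; apply: eq_bigr => l _ /=.
by rewrite mul0r mulrC (pihomogM_lt _ (hg l)).
Qed.

Section Maps.

Variables m n : nat.

Definition trip (x : V m * V m * V m) (l : 'I_3) : V m :=
  if l == i0 then x.1.1 else if l == i1 then x.1.2 else x.2.

Lemma trip_linear l : linear (trip^~ l).
Proof. by move=> c x y; rewrite /trip; case: (l == i0); case: (l == i1). Qed.

Lemma trip_inj x y : (forall l, trip x l = trip y l) -> x = y.
Proof.
case: x y => [[x0 x1] x2] [[y0 y1] y2] H.
by congr (_, _, _); [have := H i0 | have := H i1 | have := H i2].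
Qed.

Definition jmap (x : V m * V m * V m) : V n := hproj n (\sum_l (trip x l : S) * g l).

Lemma jmap_linear : linear jmap.
Proof.
move=> c x y; rewrite /jmap -linearP; congr (hproj n _).
rewrite scaler_sumr -big_split; apply: eq_bigr => l _ /=.
by rewrite trip_linear /= mulrDl scalerAl.
Qed.

HB.instance Definition _ := GRing.isLinear.Build F (V m * V m * V m)%type (V n) _ jmap jmap_linear.

Definition jspace : {vspace V n} := limg (linfun jmap).

Hypothesis mn : n = (m + E)%N.

Lemma jmapE x : jmap x = \sum_l (trip x l : S) * g l :> S.
Proof.
by apply: hprojE; rewrite mn; apply: rpred_sum => l _; apply: dhomogM; rewrite ?dhomog_is_dhomog.
Qed.

Lemma mem_ker_jmap x :
  (x \in lker (linfun jmap)) = (\sum_l (trip x l : S) * g l == 0).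
Proof. by rewrite memv_ker lfunE -jmapE. Qed.

Lemma mem_jspace (p : V n) : ideal3 g p <-> p \in jspace.
Proof.
split=> [[x E']|/memv_imgP [x _ ->]]; last first.
  by exists (fun l => trip x l : S); rewrite lfunE; apply: jmapE.
apply/memv_imgP; exists (hproj m (x i0), hproj m (x i1), hproj m (x i2)); first exact: memvf.
rewrite lfunE; apply: val_inj; rewrite [RHS]jmapE.
have -> : val p = pih n p by rewrite pihomog_dE // dhomog_is_dhomog.
rewrite {1}E' raddf_sum /=; apply: eq_bigr => l _.
rewrite mulrC mn addnC pihomogM // mulrC; congr (_ * _).
by elim/ord3P: l.
Qed.

End Maps.

Section Syzygies.

Variables (d1 d2 : nat) (rho1 rho2 : 'I_3 -> S).
Hypothesis h1 : forall l, rho1 l \is d1.-homog.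
Hypothesis h2 : forall l, rho2 l \is d2.-homog.
Hypothesis syz1 : \sum_l rho1 l * g l = 0.
Hypothesis syz2 : \sum_l rho2 l * g l = 0.
Hypothesis indep : forall x y : S, (forall l, x * rho1 l + y * rho2 l = 0) -> x = 0 /\ y = 0.
Hypothesis gen : forall a : 'I_3 -> S, \sum_l a l * g l = 0 ->
  exists x y : S, forall l, a l = x * rho1 l + y * rho2 l.

Variables m0 : nat.
(** This shape makes $m-d_1$ and $m-d_2$ the sums $m_0+d_2$ and $m_0+d_1$, free of truncated
    subtraction. *)
Let m := (m0 + d1 + d2)%N.

Definition scoord (x : V (m0 + d2) * V (m0 + d1)) l : V m :=
  hproj m ((x.1 : S) * rho1 l + (x.2 : S) * rho2 l).

Definition smap x : V m * V m * V m := (scoord x i0, scoord x i1, scoord x i2).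

Lemma smap_linear : linear smap.
Proof.
have L l : linear (scoord^~ l).
  move=> c x y; rewrite /scoord -linearP; congr (hproj m _) => /=.
  by rewrite -!mul_mpolyC; ring.
by move=> c x y; rewrite /smap !L.
Qed.

HB.instance Definition _ :=
  GRing.isLinear.Build F (V (m0 + d2) * V (m0 + d1))%type (V m * V m * V m)%type _ smap smap_linear.

Lemma smap_lfunE x : linfun smap x = smap x. Proof. exact: lfunE. Qed.

Lemma scoordE x l : scoord x l = (x.1 : S) * rho1 l + (x.2 : S) * rho2 l :> S.
Proof.
apply: hprojE; apply: rpredD.
  have -> : m = (m0 + d2 + d1)%N by rewrite /m; lia.
  by apply: dhomogM; rewrite ?dhomog_is_dhomog.
have -> : m = (m0 + d1 + d2)%N by rewrite /m; lia.
by apply: dhomogM; rewrite ?dhomog_is_dhomog.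
Qed.

Lemma trip_smap x l : trip (smap x) l = (x.1 : S) * rho1 l + (x.2 : S) * rho2 l :> S.
Proof. by rewrite -scoordE; elim/ord3P: l. Qed.

Lemma dim_syzygies n : n = (m + E)%N ->
  \dim (lker (linfun (@jmap m n))) = (\dim {: V (m0 + d2)} + \dim {: V (m0 + d1)})%N.
Proof.
move=> mn.
have -> : lker (linfun (@jmap m n)) = limg (linfun smap).
  apply/vspaceP => x; rewrite mem_ker_jmap //; apply/eqP/memv_imgP => [/gen [y1 [y2 Ey]]|[y _ ->]].
    exists (hproj (m0 + d2) y1, hproj (m0 + d1) y2); first exact: memvf.
    have Et l : trip x l = trip (smap (hproj (m0 + d2) y1, hproj (m0 + d1) y2)) l.
      apply: val_inj; rewrite /= trip_smap /=.
      have -> : trip x l = pih m (trip x l) :> S by rewrite pihomog_dE // dhomog_is_dhomog.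
      rewrite Ey pihomogD; congr (_ + _).
        have -> : m = (d1 + (m0 + d2))%N by rewrite /m; lia.
        by rewrite mulrC pihomogM // mulrC.
      have -> : m = (d2 + (m0 + d1))%N by rewrite /m; lia.
      by rewrite mulrC pihomogM // mulrC.
    by rewrite smap_lfunE; apply: trip_inj.
  rewrite smap_lfunE; under eq_bigr do rewrite trip_smap mulrDl -!mulrA.
  by rewrite big_split /= -!mulr_sumr syz1 syz2 !mulr0 addr0.
rewrite limg_dim_eq; first by rewrite !dimvf.
apply/eqP; rewrite -subv0; apply/subvP => x; rewrite memv_cap memvf memv_ker /= => /eqP sx.
have [] := indep (x := x.1) (y := x.2).
  move=> l; rewrite -trip_smap; move: sx; rewrite smap_lfunE => ->.
  by elim/ord3P: l.
move=> x10 x20; rewrite memv0; apply/eqP; case: x {sx} x10 x20 => x1 x2 /= e1 e2.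
by congr (_, _); apply: val_inj.
Qed.

(** Here $\dim J_n=3\dim S_m-\dim S_{m-d_1}-\dim S_{m-d_2}$. With $d_1+d_2=E$ the terms in $m_0$
    cancel and the codimension is the constant $E^2-d_1d_2$, written without subtraction. *)
Lemma dim_jspace n : (d1 + d2 = E)%N -> n = (m + E)%N ->
  (\dim (jspace m n) + E * E = \dim {: V n} + d1 * d2)%N.
Proof.
move=> dE mn; have := limg_ker_dim (linfun (@jmap m n)) fullv.
rewrite capfv (dim_syzygies mn) -/(jspace m n).
have -> : \dim {: (V m * V m * V m)%type} = (\dim {: V m} + \dim {: V m} + \dim {: V m})%N.
  by rewrite !dimvf.
have := dim_homog2 m; have := dim_homog2 n; have := dim_homog2 (m0 + d1); have := dim_homog2 (m0 + d2).
move: (\dim _) (\dim _) (\dim _) (\dim _) (\dim _) => a b c x y.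
rewrite mn /m -dE; nia.
Qed.

End Syzygies.

End GradedPieces.

(** * Comparing a graded piece of $S/J$ with the affine algebra *)

Section FreeQuotient.

Variable F : fieldType.
Local Notation S := {mpoly F[3]}.
Local Notation V n := (dhomog 3 F n).
Local Notation pih := (pihomog (@mdeg 3)).

Variables (E : nat) (g : 'I_3 -> S) (hg : forall l, g l \is E.-homog).
Variables (T n0 : nat).
Let J n := jspace g (n - E) n.
Hypothesis dimJ : forall n, (n0 <= n)%N -> (\dim (J n) + T = \dim {: V n})%N.
Hypothesis En0 : (E <= n0)%N.

Variable L : S.
Hypotheses (hL : L \is 1.-homog) (L0 : L != 0).
Hypothesis surjL : forall n p, (n0 <= n)%N -> p \is n.+1.-homog ->
  exists2 h, h \is n.-homog & ideal3 g (p - L * h).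

Lemma mem_J n (p : V n) : (n0 <= n)%N -> ideal3 g p <-> p \in J n.
Proof. by move=> le; apply: mem_jspace => //; rewrite subnK // (leq_trans En0). Qed.

Definition lmap n (p : V n) : V n.+1 := hproj n.+1 (L * p).

Lemma lmap_linear n : linear (@lmap n).
Proof.
move=> c x y; rewrite /lmap -linearP; congr (hproj _ _) => /=.
by rewrite -!mul_mpolyC; ring.
Qed.

HB.instance Definition _ n := GRing.isLinear.Build F (V n) (V n.+1) _ (@lmap n) (@lmap_linear n).

Lemma lmap_lfunE n x : linfun (@lmap n) x = lmap x. Proof. exact: lfunE. Qed.

Lemma lmapE n (p : V n) : lmap p = L * p :> S.
Proof. by apply: hprojE; rewrite -[n.+1]add1n; apply: dhomogM => //; apply: dhomog_is_dhomog. Qed.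

Lemma lmap_inj n : injective (@lmap n).
Proof.
move=> x y /(congr1 val); rewrite /= -[LHS]/(lmap x : S) -[RHS]/(lmap y : S) !lmapE.
by move/(mulfI L0) => e; apply: val_inj.
Qed.

(** A surjection between spaces of the same dimension $T$ is injective. Without quotients this reads
    $LJ_n=LS_n\cap J_{n+1}$, an inclusion whose two sides have equal dimension. *)
Lemma mulL_injective n p : (n0 <= n)%N -> p \is n.-homog -> ideal3 g (L * p) -> ideal3 g p.
Proof.
move=> le_n hp ILp; pose f := linfun (@lmap n).
have lkf : lker f = 0%VS.
  apply/eqP; rewrite -subv0; apply/subvP => x; rewrite memv_ker memv0 /f lmap_lfunE.
  by rewrite -(linear0 (@lmap n)) => /eqP/lmap_inj ->.
have dimf (U : {vspace V n}) : \dim (f @: U) = \dim U.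
  by rewrite limg_dim_eq // lkf capv0.
have full : (limg f + J n.+1 = fullv)%VS.
  apply/eqP; rewrite eqEsubv subvf; apply/subvP => x _.
  have [h hh Ih] := surjL le_n (dhomog_is_dhomog x).
  have -> : x = f (DHomog hh) + (x - f (DHomog hh)) by rewrite addrC subrK.
  apply: memv_add; first by apply: memv_img; apply: memvf.
  by apply/mem_J; [exact: leqW | rewrite /f lmap_lfunE /= -[X in _ - X]/(lmap (DHomog hh) : S) lmapE].
have sub : (f @: J n <= limg f :&: J n.+1)%VS.
  rewrite subv_cap limgS ?subvf //=; apply/subvP => _ /memv_imgP [y yJ ->].
  apply/mem_J; first exact: leqW.
  rewrite /f lmap_lfunE lmapE; move/mem_J: yJ => /(_ le_n) [x ->].
  by exists (fun l => L * x l); rewrite mulr_sumr; apply: eq_bigr => l _; rewrite mulrA.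
have eqJ : (f @: J n = limg f :&: J n.+1)%VS.
  apply/eqP; rewrite eqEdim sub dimf /=.
  have := dimv_sum_cap (limg f) (J n.+1); rewrite full dimf => D3.
  have aux x y z s t : (y + T = z -> x + T = t -> z + s = t + y -> s <= x)%N by lia.
  exact: aux (dimJ (leqW le_n)) (dimJ le_n) D3.
have : f (DHomog hp) \in (limg f :&: J n.+1)%VS.
  rewrite memv_cap memv_img ?memvf //=; apply/mem_J; first exact: leqW.
  by rewrite /f lmap_lfunE lmapE.
rewrite -eqJ => /memv_imgP [y yJ]; rewrite /f !lmap_lfunE => /lmap_inj e.
by have := (mem_J y le_n).2 yJ; rewrite -e.
Qed.

Lemma mulLX_injective n p s : (n0 <= n)%N -> p \is n.-homog -> ideal3 g (L ^+ s * p) -> ideal3 g p.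
Proof.
move=> le_n hp; elim: s => [|s IH]; first by rewrite expr0 mul1r.
rewrite exprS -mulrA => H; apply: IH; apply: mulL_injective H.
  exact: (leq_trans le_n (leq_addl s n)).
by apply: dhomogM => //; rewrite -[s in s.-homog]mul1n; apply: dhomogMn.
Qed.

Let idI : is_ideal (ideal3 g) := ideal3_ideal g.

Hypothesis n0_gt0 : (0 < n0)%N.

(* Comparing homogeneous components in p = j + h (L - 1) shows that h_{n+s} is
   congruent to - L^s p, which vanishes for large s. *)
Lemma affine_homog n p : (n0 <= n)%N -> p \is n.-homog ->
  adjoin (ideal3 g) (L - 1) p -> ideal3 g p.
Proof.
move=> le_n hp [h]; set j := p - h * (L - 1) => Ij.
have IjE t : ideal3 g (pih t j) by apply: ideal3_pihomog.
have jE : j = p - L * h + h by rewrite /j; ring.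
have j0 : pih 0 j = pih 0 p + pih 0 h.
  by rewrite jE pihomogD pihomogB (pihomogM_lt _ hL) // subr0.
have jS t : pih t.+1 j = pih t.+1 p - L * pih t h + pih t.+1 h.
  by rewrite jE pihomogD pihomogB -[t.+1]add1n (pihomogM _ _ hL).
have pz t : t != n -> pih t p = 0 by move=> ne; apply: (pihomog_ne0 _ hp); rewrite eq_sym.
(* Below degree $n$ there is no contribution of $p$, so the components of $h$ fall into the ideal
   one after the other from degree $0$. *)
have low t : (t < n)%N -> ideal3 g (pih t h).
  elim: t => [|t IH] lt_tn.
    by have := IjE 0%N; rewrite j0 pz ?add0r // neq_ltn lt_tn.
  have := IjE t.+1; rewrite jS pz ?neq_ltn ?lt_tn // sub0r addrC => /ideal_congr; apply=> //.
  by apply: idealMl => //; apply: IH; apply: ltnW.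
have high s : ideal3 g (pih (s + n) h + L ^+ s * p).
  elim: s => [|s IH].
    have n_gt0 : (0 < n)%N by apply: leq_trans le_n.
    rewrite add0n expr0 mul1r -(prednK n_gt0).
    have -> : pih n.-1.+1 h + p = pih n.-1.+1 j + L * pih n.-1 h.
      by rewrite jS prednK // (pihomog_dE hp); ring.
    by apply: idealD => //; apply: idealMl => //; apply: low; rewrite prednK.
  have -> : pih (s.+1 + n) h + L ^+ s.+1 * p = pih (s + n).+1 j + L * (pih (s + n) h + L ^+ s * p).
    rewrite jS pz ?exprS ?addSn; first by ring.
    by rewrite neq_ltn ltnS leq_addl orbT.
  by apply: idealD => //; apply: idealMl.
(* Past degree [msize h] the component of $h$ is zero, leaving $L^sp$ in the ideal. *)
apply: (@mulLX_injective n p (msize h)) => //.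
have := high (msize h); rewrite [pih _ h]pihomogE big_seq_cond big1 ?add0r // => m.
case/andP => /msize_mdeg_lt lt_m /eqP e; move: lt_m; rewrite e ltnNge leq_addr //.
Qed.

(** A basis of a complement of $J_{n_0}$ has $T$ elements. A dependency modulo the affine ideal
    would be homogeneous, hence in $J$ by [affine_homog], hence zero. *)
Lemma dim_le_affine_codim M : codim_le (adjoin (ideal3 g) (L - 1)) M -> (T <= M)%N.
Proof.
move=> IM; rewrite leqNgt; apply/negP => lt_MT.
pose U := (J n0)^C%VS.
have dimU : \dim U = T by rewrite dimv_compl -(dimJ (leqnn n0)) addKn.
rewrite -dimU in lt_MT.
have [v v0 Iv] := codim_le_dependent (fun i => (vbasis U)`_i : S) (adjoin_ideal idI (L - 1)) IM lt_MT.
pose w := \sum_i v 0 i *: (vbasis U)`_i.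
have wE : w = \sum_i v 0 i *: ((vbasis U)`_i : S) :> S.
  by rewrite /w raddf_sum.
have Iw : ideal3 g w.
  by apply: (affine_homog (leqnn n0)); rewrite ?wE // -wE; apply: dhomog_is_dhomog.
have : w \in (J n0 :&: U)%VS.
  rewrite memv_cap; apply/andP; split; first by apply/mem_J.
  by apply: memv_suml => i _; apply: memvZ; apply: vbasis_mem; apply: mem_nth; rewrite size_tuple.
rewrite capv_compl memv0 => /eqP w0.
case/eqP: v0; apply/rowP => i; rewrite mxE.
have /freeP : free (vbasis U) by apply: basis_free; apply: vbasisP.
by move=> /(_ (fun i => v 0 i)); apply.
Qed.

End FreeQuotient.

(** From $4d_1d_2\le E^2$ follows $E^2\le k(k-1)d^2$. With $E=kd-1$ this says $kd(d-2)+1\le0$. *)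
Lemma numeric_contradiction k d E d1 d2 M : (3 <= d)%N -> (3 <= k)%N ->
  (k * d = E.+1)%N -> (d1 + d2 = E)%N -> (E * E - d1 * d2 <= M)%N ->
  (4 * M <= 3 * (k * k.-1 * (d * d)))%N -> False.
Proof.
move=> d3 k3 kd dE TM MB.
have h1 : (4 * (d1 * d2) <= E * E)%N.
  by rewrite -dE mulnn nat_AGM2.
have h2 : (3 * (E * E) <= 3 * (k * k.-1 * (d * d)))%N by lia.
have {}h2 : (E * E <= k * k.-1 * (d * d))%N by rewrite -(leq_pmul2l (isT : 0 < 3)%N).
have h3 : (k * k.-1 * (d * d) + (k * d) * d = (k * d) * (k * d))%N.
  by case: k k3 {kd MB h2} => // k _ /=; ring.
rewrite kd in h3; nia.
Qed.

Unset Implicit Arguments.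
Set Strict Implicit.
Set Printing Implicit Defensive.

Theorem theorem5p2 (R : realType) (d k : nat) (fs : 'I_k -> S3 R) :
  (3 <= d)%N -> (3 <= k)%N ->
  d_arrangement d fs ->
  (forall v : 'I_3 -> CC R, nonzero_vec v -> (mult_at fs v < 5)%N) ->
  ~ free_curve (\prod_(i < k) fs i).
Proof.
move=> d3 k3 [_ [hfs [irr [smooth [_ trans]]]]] mult4.
move=> [D [hfD [d1 [d2 [rho1 [rho2 [dD [h1 [h2 [syz1 [syz2 [indep [gen _]]]]]]]]]]]]].
set F : numClosedFieldType := CC R.
have smooth' i : smooth_form (F := F) (fs i) by move=> v vnz fv; apply: smooth.
have trans' i j : i != j -> transversal (F := F) (fs i) (fs j).
  by move=> ne v vnz fi fj; apply: trans.
have [e kd] : exists e, (k * d = e.+2)%N by exists (k * d - 2)%N; nia.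
have f0 : \prod_i fs i != 0 by apply/prodf_neq0 => i _; case: (irr i) => _ [].
have DE : D = e.+2 by rewrite -kd; apply: dhomog_uniq f0 hfD (prod_homog hfs).
have dE : (d1 + d2 = e.+1)%N by rewrite dD DE.
have [q [a [b [l1 [l2 [l3 [frame L0 line_nz fq cop]]]]]]] := exists_good_frame (F := F) hfs smooth' trans'.
have [M IM MB] := affine_codim_le hfs smooth' trans' frame line_nz fq cop kd mult4.
apply: (numeric_contradiction (E := e.+1) d3 k3 kd dE _ MB).
have hg l : mderiv l (\prod_i fs i) \is e.+1.-homog := df_homog hfs kd l.
(* From degree $2(e+1)$ on, $n-(e+1)\ge d_1+d_2$, so the dimension formula applies, and $L$ is
   surjective as well. *)
apply: (dim_le_affine_codim (F := F) hg (n0 := (e.+1 + e.+1)%N) _ _ (lin_homog l3)) IM => //.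
- move=> n le_n.
  have [m0 nE] : exists m0, n = (m0 + d1 + d2 + e.+1)%N by exists (n - (e.+1 + e.+1))%N; lia.
  have -> : (n - e.+1 = m0 + d1 + d2)%N by lia.
  have := dim_jspace hg h1 h2 syz1 syz2 indep gen dE nE.
  have aux x y : (x + e.+1 * e.+1 = y + d1 * d2 -> x + (e.+1 * e.+1 - d1 * d2) = y)%N.
    by have le : (d1 * d2 <= e.+1 * e.+1)%N; [rewrite -dE; nia | lia].
  exact: aux.
- exact: leq_addr.
- by move=> n p le_n hp; apply: (mulL_surjective hfs smooth' frame line_nz fq cop kd _ hp); lia.
Qed.
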